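(* Let $N\ge2$. The generating functions $G_K$ defined in the context satisfy, as formal power series, $$G_N(t,x_1, \dots, x_{N-1}) = \left( 2t\frac{\partial}{\partial t} - \sum_{k=1}^{N-1}x_k \frac{\partial}{\partial x_k}\right) G_{N-1}(t,x_1, \dots, x_{N-1})$$ and $$G_N(t, x_1, \dotsc, x_N) = t x_1 \sum_{\substack{ I \cup J = \{ x_2, \dotsc, x_N\}\\ I\cap J=\emptyset }} G_{|I|+1}(t, x_1, I)\, G_{|J|+1}(t, J) + t x_1\sum_{r=2}^N\ \sum_{\substack{I \cup J = \{x_2, \dotsc, \hat x_r, \dotsc, x_N\} \\ I\cap J=\emptyset}} x_r \, G_{|I|+1}(t, x_1, I)\, \frac{\partial}{\partial x_r}\Bigl\{x_r\,G_{|J|+1}(t, x_r, J) \Bigr\}.$$ The inner sums run over all ordered pairs $(I,J)$ of (possibly empty) disjoint sets whose union is the indicated set of variables, and a hat means that the element is omitted.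
   Context: A plane tree with $e\ge1$ edges is a triple $\Gamma=(H,\alpha,\sigma)$, where $H$ is a set of $2e$ half-edges and $\alpha,\sigma$ are permutations of $H$ such that $\alpha$ is a fixed-point-free involution, the group generated by $\alpha,\sigma$ acts transitively on $H$, and $\sigma$ has exactly $e+1$ cycles (fixed points counted as cycles). Cycles of $\alpha$ are the edges, cycles of $\sigma$ are the vertices (with the cyclic order of half-edges around them), and the degree of a vertex is the length of its cycle. An $N$-rooted tree ($N\ge1$) is a plane tree together with $N$ distinct half-edges (roots) belonging to $N$ distinct cycles of $\sigma$; the corresponding $N$ vertices (root vertices) are labeled $v_1,\dots,v_N$. An isomorphism of $N$-rooted trees $(H,\alpha,\sigma)\to(H',\alpha',\sigma')$ is a bijection $\varphi:H\to H'$ with $\alpha=\varphi^{-1}\alpha'\varphi$, $\sigma=\varphi^{-1}\sigma'\varphi$, sending the $k$th root to the $k$th root for all $k$. Isomorphic trees are identified. As an exceptional case, the graph with one vertex (of degree $0$) and no edges counts as a one-rooted tree with $e=0$, and it is the only $N$-rooted tree with $e=0$. $T_N(e;d_1,\dots,d_s)$, $0\le s\le N$, is the number of $N$-rooted trees with $e$ edges in which the root vertex $v_j$ has degree $d_j$ for $j=1,\dots,s$ (the degrees of the other root vertices are unconstrained). In particular $T_1(0)=T_1(0;0)=1$. For $0\le s\le N$, $N\ge 1$, define the formal power series in $t$ with coefficients polynomial in $x_1,\dots,x_s$: $$G_N(t,x_1, \dots, x_s) = \sum_{d_1=0}^\infty \dots \sum_{d_s=0}^\infty \, \sum_{e=0}^\infty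 T_N(e;d_1, \dots, d_s) \, x_1^{d_1}\cdots x_s^{d_s} t^e .$$ One has $G_N(t,x_1,\dots,x_s)=G_N(t,x_1,\dots,x_s,1,\dots,1)$. These functions are symmetric in $x_1,\dots,x_s$, so for a set $I$ of variables the notation $G_M(t,x_1,I)$ (the elements of $I$ inserted as arguments) is unambiguous; $G_1(t,\emptyset)$ means $G_1(t)=\sum_{e\ge0}T_1(e)t^e=G_1(t,1)$. *)

(* Defs.v *)
From HB Require Import structures.
From mathcomp Require Import all_boot all_order all_algebra all_fingroup.
From mathcomp Require boolp.
From mathcomp Require Import mpoly.

Set Implicit Arguments.
Unset Strict Implicit.
Unset Printing Implicit Defensive.

Import GRing.Theory.

Local Open Scope ring_scope.

Record fps (A : Type) := FPS { fps_coef :> nat -> A }.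

Lemma fpsP (A : Type) (f g : fps A) : f =1 g <-> f = g.
Proof.
split=> [|->//]; case: f g => [f] [g] /= fg.
by congr FPS; apply: boolp.funext.
Qed.

HB.instance Definition _ (A : Type) := boolp.gen_eqMixin (fps A).
HB.instance Definition _ (A : Type) := boolp.gen_choiceMixin (fps A).

Section FpsRing.
Variable A : comNzRingType.
Implicit Types f g h : fps A.

Definition fps_const (a : A) : fps A := FPS (fun n => if n == 0%N then a else 0).
Definition fps_t : fps A := FPS (fun n => (n == 1%N)%:R).
Definition fps_add f g : fps A := FPS (fun n => f n + g n).
Definition fps_opp f : fps A := FPS (fun n => - f n).
Definition fps_mul f g : fps A :=
  FPS (fun n => \sum_(i < n.+1) f i * g (n - i)%N).

Lemma fps_addA : associative fps_add.
Proof. by move=> f g h; apply/fpsP => n /=; rewrite addrA. Qed.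

Lemma fps_addC : commutative fps_add.
Proof. by move=> f g; apply/fpsP => n /=; rewrite addrC. Qed.

Lemma fps_add0 : left_id (fps_const 0) fps_add.
Proof. by move=> f; apply/fpsP => n /=; rewrite if_same add0r. Qed.

Lemma fps_addN : left_inverse (fps_const 0) fps_opp fps_add.
Proof. by move=> f; apply/fpsP => n /=; rewrite if_same addNr. Qed.

HB.instance Definition _ :=
  GRing.isZmodule.Build (fps A) fps_addA fps_addC fps_add0 fps_addN.

Definition fps_trunc n f : {poly A} := \poly_(i < n.+1) f i.

Lemma coef_fps_trunc n f k : (k <= n)%N -> (fps_trunc n f)`_k = f k.
Proof. by move=> le_kn; rewrite coef_poly ltnS le_kn. Qed.

Lemma coef_fps_mul n f g (p q : {poly A}) :
    (forall k, (k <= n)%N -> p`_k = f k) ->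
    (forall k, (k <= n)%N -> q`_k = g k) ->
  forall k, (k <= n)%N -> (p * q)`_k = fps_mul f g k.
Proof.
move=> pf qg k le_kn; rewrite coefM; apply: eq_bigr => i _.
rewrite pf ?qg ?(leq_trans _ le_kn) ?leq_subr //.
by rewrite -ltnS.
Qed.

Lemma fps_mulA : associative fps_mul.
Proof.
move=> f g h; apply/fpsP => n.
have tr u k := @coef_fps_trunc n u k.
have m u v := coef_fps_mul (@tr u) (@tr v).
rewrite -(coef_fps_mul (@tr f) (@m g h) (leqnn n)).
by rewrite -(coef_fps_mul (@m f g) (@tr h) (leqnn n)) mulrA.
Qed.

Lemma fps_mulC : commutative fps_mul.
Proof.
move=> f g; apply/fpsP => n.
have tr u k := @coef_fps_trunc n u k.
rewrite -(coef_fps_mul (@tr f) (@tr g) (leqnn n)) mulrC.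
by rewrite (coef_fps_mul (@tr g) (@tr f)).
Qed.

Lemma fps_mul1 : left_id (fps_const 1) fps_mul.
Proof.
move=> f; apply/fpsP => n /=.
rewrite big_ord_recl /= mul1r subn0 big1 ?addr0 // => i _.
by rewrite mul0r.
Qed.

Lemma fps_mulDl : left_distributive fps_mul fps_add.
Proof.
move=> f g h; apply/fpsP => n /=; rewrite -big_split /=.
by apply: eq_bigr => i _; rewrite mulrDl.
Qed.

Lemma fps_oner_neq0 : fps_const 1 != 0 :> fps A.
Proof.
apply/eqP => /fpsP /(_ 0%N) /= /eqP.
by rewrite oner_eq0.
Qed.

HB.instance Definition _ := GRing.Zmodule_isComNzRing.Build (fps A)
  fps_mulA fps_mulC fps_mul1 fps_mulDl fps_oner_neq0.

Definition fps_deriv f : fps A := FPS (fun n => f n.+1 *+ n.+1).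

End FpsRing.

Arguments fps_t {A}.

Definition fps_map (A B : Type) (u : A -> B) (f : fps A) : fps B :=
  FPS (fun n => u (f n)).

Section RootedTrees.
Variable H : finType.
Implicit Types al sg : {perm H}.

(* Never holds for [e = 0]: the empty set of half-edges has no cycle. *)
Definition plane_tree (e : nat) al sg : bool :=
  [&& #|H| == (2 * e)%N,
      [forall h, (al h != h) && (al (al h) == h)],
      [transitive <<[set al; sg]>>%g, on [set: H] | 'P]
    & #|porbits sg| == e.+1].

Definition vertex_degree sg (h : H) : nat := #|porbit sg h|.

Definition rooted_tree (N e : nat) (G : {perm H} * {perm H} * N.-tuple H) :=
  let: (al, sg, r) := G in
  plane_tree e al sg && uniq [seq porbit sg h | h <- r].

Definition rtree_iso (N : nat) : rel ({perm H} * {perm H} * N.-tuple H) :=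
  fun G G' =>
  let: (al, sg, r) := G in let: (al', sg', r') := G' in
  [exists phi : {perm H},
    [&& [forall h, phi (al h) == al' (phi h)],
        [forall h, phi (sg h) == sg' (phi h)]
      & [forall k, phi (tnth r k) == tnth r' k]]].

(* The root of [v_(j+1)] is [tnth r j]; only the first [s <= N] root vertices
   are constrained. *)
Definition root_degrees (N s : nat) (d : 'I_s -> nat)
    (G : {perm H} * {perm H} * N.-tuple H) : bool :=
  let: (_, sg, r) := G in
  [forall j : 'I_s, exists k : 'I_N,
     (k == j :> nat) && (vertex_degree sg (tnth r k) == d j)].

End RootedTrees.

(* [T_N(e; d_1, ..., d_s)], for [s <= N]. Since every set of [2e] half-edges is
   in bijection with ['I_(2 * e)], the isomorphism classes are those of the
   trees carried by ['I_(2 * e)]. The case [e = 0] is the exceptional tree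
   with one vertex of degree 0. *)
Definition num_trees (N s e : nat) (d : 'I_s -> nat) : nat :=
  if e == 0%N then nat_of_bool ((N == 1%N) && [forall j, d j == 0%N])
  else #|equivalence_partition (@rtree_iso 'I_(2 * e) N)
           [set G | rooted_tree e G && root_degrees d G]|.

(* The variable [x_(j+1)] is ['X_j]. The degrees are summed up to [2 * e], the
   number of half-edges, without loss; see [mcoeff_gen]. *)
Definition gen (N s : nat) : fps {mpoly int[s]} :=
  FPS (fun e => \sum_(d : {ffun 'I_s -> 'I_(2 * e).+1})
    (num_trees N e (fun j => d j : nat))%:R *: \prod_j 'X_j ^+ d j).

Lemma num_trees_large (N s e : nat) (d : 'I_s -> nat) (j : 'I_s) :
  (2 * e < d j)%N -> num_trees N e d = 0%N.
Proof.
move=> lt_d; rewrite /num_trees; case: eqP => [e0|_].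
  rewrite (_ : [forall _, _] = false) ?andbF //; apply/forallP => /(_ j).
  by move=> /eqP dj0; rewrite dj0 in lt_d.
rewrite (_ : [set G | _] = set0); first by rewrite /equivalence_partition imset0 cards0.
apply/setP => -[[al sg] r]; rewrite !inE /=; apply/negbTE.
rewrite negb_and orbC -implybE; apply/implyP => /forallP/(_ j)/existsP[k].
case/andP => _ /eqP dk; move: lt_d; rewrite -dk /vertex_degree ltnNge.
by rewrite -[X in (_ <= X)%N]card_ord max_card.
Qed.

Lemma mcoeff_gen (N s e : nat) (m : 'X_{1..s}) :
  (gen N s e)@_m = (num_trees N e m)%:R.
Proof.
have monE (d : {ffun 'I_s -> 'I_(2 * e).+1}) :
    \prod_j 'X_j ^+ d j = 'X_[ [multinom (d j : nat) | j < s] ] :> {mpoly int[s]}.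
  by rewrite mpolyXE_id; apply: eq_bigr => j _; rewrite mnmE.
rewrite /= raddf_sum /=.
under eq_bigr => d _ do rewrite monE mcoeffZ mcoeffX.
have [/forallP le_m | /forallPn[j]] := boolP [forall j, (m j < (2 * e).+1)%N].
  pose d0 : {ffun 'I_s -> 'I_(2 * e).+1} := [ffun j => Ordinal (le_m j)].
  rewrite (bigD1 d0) //= big1 => [|d /negP neq_d].
    rewrite addr0 (_ : [multinom _ | _ < _] = m) ?eqxx ?mulr1.
      congr ((num_trees _ _ _)%:R); apply: boolp.funext => j.
      by rewrite ffunE.
    by apply/mnmP => j; rewrite mnmE ffunE.
  case: eqP => [dm|]; last by rewrite mulr0.
  case: neq_d; apply/eqP/ffunP => j; apply/val_inj.
  by rewrite ffunE /= -dm mnmE.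
rewrite -leqNgt => lt_m; rewrite (num_trees_large _ lt_m) big1 // => d _.
case: eqP => [dm|]; last by rewrite mulr0.
by move: lt_m; rewrite -dm mnmE leqNgt ltn_ord.
Qed.

(* [G_M(t, x_i1, ..., x_is)] for [vs = [:: i1; ...; is]], as a series with
   coefficients in the polynomials in all the variables. *)
Definition gen_at (n M : nat) (vs : seq 'I_n) : fps {mpoly int[n]} :=
  fps_map (comp_mpoly [tuple 'X_(tnth (in_tuple vs) j) | j < size vs])
          (gen M (size vs)).

(* Main.v *)
Require Import Defs.
From HB Require Import structures.
From mathcomp Require Import all_boot all_order all_algebra all_fingroup.
From mathcomp Require Import mpoly.
From mathcomp Require boolp.
From mathcomp Require Import zify.

(** Both identities are proved on coefficients, after every generating function
    has been rewritten as a sum over binary trees.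

    A plane tree whose first root is fixed has no automorphism, and it splits at
    its root edge into the part [l] that keeps the root vertex and the part [r]
    hanging from the other end, each rooted at the next half-edge around its
    vertex. Iterating, a one-rooted plane tree is a binary tree [Node l r], with
    [Leaf] for the tree without edges. The other roots are half-edges chosen at
    distinct vertices, so they only see the list of vertex degrees:
    [other_degrees (Node l r)] is the degree of the far end of the root edge,
    which is one more than the root degree of [r], followed by the lists of [l]
    and [r]. The total weight of the choices for a set [S] of labels is
    [place degrees S]; concatenating lists of degrees amounts to distributing
    the labels ([place_cat]). The second identity is this decomposition: its two
    sums correspond to the far end of the root edge being unlabelled or not, and
    in the second case the derivative supplies the factor equal to its degree,
    the number of places for its root. The first identity holds because a last, unconstrained root
    may be any of the [2e - sum_k d_k] half-edges outside the vertices already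
    chosen ([gen_free_root]).

    The substance is the correspondence between isomorphism classes of pairs of
    permutations and binary trees, which goes through the contour of the tree,
    the permutation [al * sg] (first [al], then [sg]). Writing [al] as a product
    of [e] transpositions, each factor merges two cycles or splits one. The
    merges have to connect the [e + 1] vertices, so all factors merge, and the
    contour is a single cycle ([genus_inequality], [plane_tree_face]). Hence
    every class has exactly one representative on ['I_(2 * e)] whose contour is
    the rotation [i |-> i + 1] and whose first root is 0
    ([num_trees_canonical]). Read from the contour, which has one cycle, to
    [sg], which has [e + 1], all [e] factors have to split, in whichever order
    they are taken; two crossing edges would contradict this
    ([noncrossing_cycles]). So [al] is a noncrossing matching of the [2e]
    positions, that is, a well-parenthesized word ([noncrossing_mate]), and such
    words are binary trees. The cycles of [sg] are then computed by recursion
    along the binary tree ([root_cycle], [other_cycles]). *)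

Set Implicit Arguments.
Unset Strict Implicit.
Unset Printing Implicit Defensive.

(** * Binary trees and their contour words *)

(** A one-rooted plane tree: in [Node l r], removing the root edge leaves [l] at
    the root vertex and [r] at the other end. *)
Inductive bintree := Leaf | Node of bintree & bintree.

HB.instance Definition _ := boolp.gen_eqMixin bintree.

Fixpoint nodes (b : bintree) : nat :=
  if b is Node l r then (nodes l + nodes r).+1 else 0.

(** The half-edges are numbered along the contour, starting from the root. The
    contour of [Node l r] is the word [( r ) l], whose parentheses are the two
    halves of the root edge, and [mate] is the matching of parentheses. It is
    the identity beyond the end of the word. *)
Fixpoint mate (b : bintree) (i : nat) : nat :=
  if b is Node l r then
    let k := (2 * nodes r).+1 in
    if i == 0 then k else if i < k then (mate r i.-1).+1
    else if i == k then 0 else mate l (i - k.+1) + k.+1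
  else i.

Lemma mate_lt b i : (mate b i < 2 * nodes b) = (i < 2 * nodes b).
Proof.
elim: b i => [|l IHl r IHr] i //=.
case: eqP => [->|i0]; first by lia.
case: (ltnP i (_.+1)) => [ik|ki]; first by have := IHr i.-1; lia.
case: eqP => [->|ik]; first by lia.
by have := IHl (i - (2 * nodes r).+2); lia.
Qed.

Lemma mateK b : involutive (mate b).
Proof.
elim: b => [|l IHl r IHr] i //=.
case: (i =P 0) => [->|i0] /=; first by rewrite ltnn eqxx.
case: (ltnP i) => [ik|ki] /=.
  have lt_m : mate r i.-1 < 2 * nodes r by rewrite mate_lt; lia.
  by rewrite ltnS lt_m IHr; lia.
case: (i =P (2 * nodes r).+1) => [->|ik] //=.
rewrite addnK IHl.
rewrite !ifF; try lia.
Qed.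

Lemma mate_neq b i : i < 2 * nodes b -> mate b i != i.
Proof.
elim: b i => [|l IHl r IHr] i //= ib.
case: (i =P 0) => [->|i0] /=; first by lia.
case: (ltnP i) => [ik|ki] /=; first by have := IHr i.-1; lia.
case: (i =P (2 * nodes r).+1) => [->|ik] //=.
by have := IHl (i - (2 * nodes r).+2); lia.
Qed.

(** The position matched with 0 gives the size of the right subtree, and hence
    the places where both subtrees are to be read. *)
Lemma mate_inj b b' : nodes b = nodes b' ->
  (forall i, i < 2 * nodes b -> mate b i = mate b' i) -> b = b'.
Proof.
elim: b b' => [|l IHl r IHr] [|l' r'] //= [eqn] eqm.
have eqr : nodes r = nodes r' by have := eqm 0; rewrite eqxx; lia.
have eql : nodes l = nodes l' by lia.
congr Node; [apply: IHl => // i ib | apply: IHr => // i ib].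
  have := eqm (i + (2 * nodes r).+2); rewrite -eqr addnK.
  by do !case: ifP; lia.
have := eqm i.+1; rewrite -eqr ltnS ib /=; lia.
Qed.

(** No pair crosses [{l, f l}], so [f] preserves the positions strictly between
    [l] and [f l] and those after [f l]; these two intervals carry the right and
    the left subtree. *)
Lemma noncrossing_mate (f : nat -> nat) (l u : nat) :
    l <= u -> (forall i, l <= i < u -> l <= f i < u) ->
    (forall i, l <= i < u -> f (f i) = i /\ f i != i) ->
    (forall a c, l <= a -> a < c < f a -> f a < u -> a < f c < f a) ->
  exists2 b, u = l + 2 * nodes b
           & forall i, i < 2 * nodes b -> f (l + i) = l + mate b i.
Proof.
have [n] := ubnP (u - l); elim: n l u => // n IHn l u le_n le_lu fr fK nc.
have [<-|lt_lu] := eqVneq l u; first by exists Leaf; rewrite ?muln0 ?addn0.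
have frl := fr l ltac:(lia); have [fKl fl] := fK l ltac:(lia).
have bl c : l < c < f l -> l < f c < f l by move=> cl; apply: nc; lia.
have ar c : f l < c < u -> f l < f c < u.
  move=> cl; have := fr c ltac:(lia); have [fKc fc] := fK c ltac:(lia).
  have fcl : f c <> l by move=> e; move: fKc; rewrite e; lia.
  have fcfl : f c <> f l.
    by move=> e; move: fKc; rewrite e fKl; lia.
  have : ~ (l < f c < f l) by move/bl; rewrite fKc; lia.
  lia.
have [r er fr'] : exists2 b, f l = l.+1 + 2 * nodes b
    & forall i, i < 2 * nodes b -> f (l.+1 + i) = l.+1 + mate b i.
  apply: IHn => [||i il|i il|a c al ac fa]; try lia; first by apply: bl; lia.
    by apply: fK; lia.
  by apply: nc; lia.
have [t et ft] : exists2 b, u = (f l).+1 + 2 * nodes b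
    & forall i, i < 2 * nodes b -> f ((f l).+1 + i) = (f l).+1 + mate b i.
  apply: IHn => [||i il|i il|a c al ac fa]; try lia; first by apply: ar; lia.
    by apply: fK; lia.
  by apply: nc; lia.
exists (Node t r) => /=; first by lia.
move=> i lt_i; case: (i =P 0) => [->|i0] /=; first by rewrite addn0; lia.
case: ltnP => ik; first by have := fr' i.-1; rewrite (_ : l.+1 + i.-1 = l + i); lia.
case: eqP => [->|ik']; first by rewrite (_ : l + _ = f l) ?fKl; lia.
have := ft (i - (2 * nodes r).+2).
by rewrite (_ : (f l).+1 + _ = l + i); lia.
Qed.

(** The vertices as lists of contour positions in the order of the vertex
    permutation. In [Node l r] the half-edge 0 is put in front of the root vertex
    of [l], and its mate in front of the root vertex of [r]. *)
Fixpoint root_cycle (b : bintree) : seq nat :=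
  if b is Node l r then 0 :: map (addn (2 * nodes r).+2) (root_cycle l) else [::].

Fixpoint other_cycles (b : bintree) : seq (seq nat) :=
  if b is Node l r then
    ((2 * nodes r).+1 :: map succn (root_cycle r))
    :: map (map (addn (2 * nodes r).+2)) (other_cycles l)
       ++ map (map succn) (other_cycles r)
  else [::].

(** Turning around a vertex: cross the edge, then advance along the contour. At
    the last half-edge of the root vertex the value is the length of the word,
    which stands for the return to position 0. *)
Definition step (b : bintree) (i : nat) := (mate b i).+1.

Lemma step_node_r l r i : i < 2 * nodes r -> step (Node l r) i.+1 = (step r i).+1.
Proof. by move=> ir; rewrite /step /= ltnS ir. Qed.

Lemma step_node_l l r i :
  step (Node l r) ((2 * nodes r).+2 + i) = (2 * nodes r).+2 + step l i.
Proof.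
by rewrite /step /= !ifF; try lia; rewrite addKn; lia.
Qed.

Lemma size_other_cycles b : size (other_cycles b) = nodes b.
Proof. by elim: b => //= l IHl r IHr; rewrite size_cat !size_map IHl IHr. Qed.

Lemma perm_cycles b :
  perm_eq (flatten (root_cycle b :: other_cycles b)) (iota 0 (2 * nodes b)).
Proof.
elim: b => // l IHl r IHr.
have /seq.permP pl := perm_map (addn (2 * nodes r).+2) IHl.
have /seq.permP pr := perm_map succn IHr.
have -> : 2 * nodes (Node l r) =
    1 + (2 * nodes r + (1 + 2 * nodes l)) by rewrite /=; lia.
rewrite [root_cycle _]/= [other_cycles _]/=.
move: pl pr; move: (2 * nodes r) (2 * nodes l) => nr nl pl pr.
apply/seq.permP => p; move: (pl p) (pr p).
rewrite -[X in map succn (iota 0 X)]add0n -(iotaDl nr.+2 0) -(iotaDl 1 0).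
rewrite addn0 !iotaD /= flatten_cat /= -!map_flatten.
rewrite !(count_cat, map_cat) /= !count_cat /=.
rewrite (_ : 0 + 1 + nr + 1 = nr.+2); last by lia.
rewrite !addn0 add0n add1n; lia.
Qed.

(** The bound on [i] makes the relation stable under both embeddings of a subtree
    into a tree, with no condition on [j]. *)
Definition step_rel (b : bintree) : rel nat :=
  [rel i j | (i < 2 * nodes b) && (step b i == j)].

Lemma step_rel_l l r i j : step_rel l i j ->
  step_rel (Node l r) ((2 * nodes r).+2 + i) ((2 * nodes r).+2 + j).
Proof.
by case/andP => lt_i /eqP <-; rewrite /step_rel /= step_node_l eqxx andbT; lia.
Qed.

Lemma step_rel_r l r i j : step_rel r i j -> step_rel (Node l r) i.+1 j.+1.
Proof.
by case/andP => lt_i /eqP <-; rewrite /step_rel /= step_node_r // eqxx andbT; lia.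
Qed.

(** The exit value of a subtree is its length, and shifting it gives the exit
    value of the whole word (left subtree) or the position of the mate of the
    root (right subtree), where the turn around the vertex goes on. *)
Lemma root_cycleP b : exists2 s, rcons (root_cycle b) (2 * nodes b) = 0 :: s
  & path (step_rel b) 0 s.
Proof.
elim: b => [|l [s es ps] r _] /=; first by exists [::].
exists (map (addn (2 * nodes r).+2) (0 :: s)).
  by rewrite -es map_rcons; congr (_ :: rcons _ _); lia.
rewrite /= addn0; apply/andP; split; first by rewrite /step_rel /step /= eqxx.
rewrite -{1}[(2 * nodes r).+2]addn0.
by apply: homo_path ps => i j; apply: step_rel_l.
Qed.

Lemma other_cyclesP b c : c \in other_cycles b -> path.cycle (step_rel b) c.
Proof.
elim: b c => // l IHl r IHr c /=; rewrite in_cons mem_cat => /or3P[].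
- move/eqP => ->; have [s es ps] := root_cycleP r.
  have e : rcons (map succn (root_cycle r)) (2 * nodes r).+1 = map succn (0 :: s).
    by rewrite -es map_rcons.
  rewrite /= e /= {1}/step_rel /= /step /= ltnn eqxx /= andbT; apply/andP; split.
    by lia.
  by apply: homo_path ps => i j; apply: step_rel_r.
- case/mapP => c' /IHl cp ->.
  by apply: homo_cycle cp => i j; apply: step_rel_l.
- case/mapP => c' /IHr cp ->.
  by apply: homo_cycle cp => i j; apply: step_rel_r.
Qed.

(** Bounding the height gives a structural recursion; it reaches every tree with
    fewer than [h] nodes. *)
Fixpoint trees_to (h : nat) : seq bintree :=
  if h is h'.+1 then
    Leaf :: [seq Node l r | l <- trees_to h', r <- trees_to h']
  else [::].

Definition trees (e : nat) := [seq b <- trees_to e.+1 | nodes b == e].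

Lemma trees_to_uniq h : uniq (trees_to h).
Proof.
elim: h => //= h IHh; apply/andP; split; first by apply/allpairsP => -[[l r] []].
by apply: allpairs_uniq => // -[l r] [l' r'] _ _ [-> ->].
Qed.

Lemma mem_trees_to h b : nodes b < h -> b \in trees_to h.
Proof.
elim: h b => // h IHh [|l r] lt_b; first exact: mem_head.
rewrite in_cons; apply/orP; right; apply/allpairsP; exists (l, r).
by move: lt_b => /= ?; split => //; apply: IHh; lia.
Qed.

Lemma mem_trees e b : (b \in trees e) = (nodes b == e).
Proof.
rewrite mem_filter andb_idr // => /eqP <-; exact: mem_trees_to.
Qed.

Lemma trees_uniq e : uniq (trees e).
Proof. exact/filter_uniq/trees_to_uniq. Qed.

Lemma big_trees0 (R : Type) (idx : R) (op : Monoid.law idx) (F : bintree -> R) :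
  \big[op/idx]_(b <- trees 0) F b = F Leaf.
Proof. by rewrite /trees /= big_seq1. Qed.

Lemma big_treesS (R : Type) (idx : R) (op : Monoid.com_law idx) e
    (F : bintree -> R) :
  \big[op/idx]_(b <- trees e.+1) F b =
  \big[op/idx]_(i < e.+1) \big[op/idx]_(l <- trees i)
    \big[op/idx]_(r <- trees (e - i)) F (Node l r).
Proof.
pose s := [seq Node p.1 p.2 |
  i <- iota 0 e.+1, p <- [seq (l, r) | l <- trees i, r <- trees (e - i)]].
have ts : perm_eq (trees e.+1) s.
  apply: uniq_perm; first exact: trees_uniq.
    apply: allpairs_uniq_dep => [|i _|]; first exact: iota_uniq.
      by apply: allpairs_uniq; rewrite ?trees_uniq // => -[? ?] [? ?].
    move=> _ _ /allpairsPdep[i [p [_ pi ->]]] /allpairsPdep[j [q [_ qj ->]]] /=.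
    case/allpairsP: pi => -[l r] /= [+ _ ->]; rewrite mem_trees => /eqP li.
    case/allpairsP: qj => -[l' r'] /= [+ _ ->]; rewrite mem_trees => /eqP lj.
    by case=> el er; rewrite -li -lj el er.
  move=> b; rewrite mem_trees; apply/eqP/allpairsPdep => [|[i [p [+ + ->]]]].
    case: b => // l r [elr]; exists (nodes l), (l, r); split => //.
      by rewrite mem_iota; lia.
    by apply/allpairsP; exists (l, r); split => //=; rewrite mem_trees; lia.
  rewrite mem_iota => lt_i /allpairsP[[l r] /= [+ + ->]].
  by rewrite !mem_trees /=; lia.
rewrite (perm_big _ ts) big_allpairs_dep -[e.+1 in LHS]subn0.
rewrite -/(index_iota 0 e.+1) big_mkord.
by apply: eq_bigr => i _; rewrite big_allpairs.
Qed.

(** * Counting the faces of a plane tree *)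

Section Genus.
Variable T : finType.
Implicit Types (s al : {perm T}) (ts : seq (T * T)).

Definition tperms ts : {perm T} := (\prod_(p <- ts) tperm p.1 p.2)%g.

Lemma tperms_cons_mul x y ts s :
  (tperms ((x, y) :: ts) * s = tperm x y * (tperms ts * s))%g.
Proof. by rewrite /tperms big_cons mulgA. Qed.

(** Multiplication by a transposition splits a cycle or merges two. *)
Lemma card_porbits_tperm x y s : #|porbits (tperm x y * s)%g| <= #|porbits s|.+1.
Proof. by have /= := porbits_mul_tperm s x y; lia. Qed.

Lemma card_porbits_tperm_merge x y s :
  x \notin porbit s y -> #|porbits (tperm x y * s)%g| < #|porbits s|.
Proof.
move=> xy; have /= := porbits_mul_tperm s x y; rewrite xy.
by case: eqP => [xy_eq|_]; [rewrite xy_eq porbit_id in xy | lia].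
Qed.

Lemma card_porbits_tperms ts s :
  #|porbits (tperms ts * s)%g| <= #|porbits s| + size ts.
Proof.
elim: ts => [|[x y] ts IHts]; first by rewrite /tperms big_nil mul1g addn0.
rewrite tperms_cons_mul; apply: leq_trans (card_porbits_tperm _ _ _) _.
by rewrite addnS ltnS.
Qed.

(** The Euler inequality. The function [c] labels the points by the connected
    components generated by [s] and the transpositions. A factor that merges two
    cycles merges at most two components: the left side drops by 1, and the right
    side by at most 1. A factor that splits a cycle acts inside a component, and
    both sides grow by 1. *)
Lemma genus_inequality ts s : exists c : T -> {set T},
  [/\ forall x, c (s x) = c x, forall x, c ((tperms ts * s)%g x) = c x
    & #|porbits s| + #|porbits (tperms ts * s)%g| <= 2 * #|c @: T| + size ts].
Proof.
elim: ts => [|[x y] ts [c [cs cp le_c]]].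
  exists (porbit s); rewrite /tperms big_nil mul1g.
  have inv x : porbit s (s x) = porbit s x by rewrite (porbit_perm s 1).
  by split=> //; rewrite addn0 mul2n -addnn.
rewrite tperms_cons_mul /=; move: (tperms ts * s)%g cp le_c => p cp le_c.
have [xy|xy] := boolP (x \in porbit p y).
  have cxy : c x = c y.
    case/porbitP: xy => i ->; elim: i => [|i IHi]; first by rewrite perm1.
    by rewrite expgSr permM cp.
  exists c; split=> // [z|].
    by rewrite permM cp; case: tpermP => // ->.
  apply: leq_trans (leq_add (leqnn _) (card_porbits_tperm x y p)) _.
  by rewrite !addnS ltnS.
(* The components of [x] and [y] are merged by sending the former to the latter. *)
pose m (C : {set T}) := if C == c x then c y else C.
exists (m \o c); split=> [z|z|].
- by rewrite /= cs.
- by rewrite permM /= cp; case: tpermP => // ->; rewrite /m eqxx if_same.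
rewrite -ltnS -addnS; apply: leq_trans (leq_add (leqnn _) _) _.
  exact: card_porbits_tperm_merge xy.
apply: leq_trans le_c _.
have : c @: T \subset c x |: (m \o c) @: T.
  apply/subsetP => _ /imsetP[z _ ->]; rewrite !inE.
  case: eqP => //= cz; apply/imsetP; exists z => //=.
  by rewrite /m; case: eqP.
by move/subset_leq_card; rewrite cardsU1; case: (_ \notin _) => /=; lia.
Qed.

Definition moved al := [set x | al x != x].

Section RemoveEdge.
Variables (al : {perm T}) (x : T).
Hypotheses (alK : involutive al) (alx : al x != x).

Definition remove_edge : {perm T} := (al * tperm x (al x))%g.

Lemma remove_edgeE y :
  remove_edge y = if (y == x) || (y == al x) then y else al y.
Proof.
rewrite permM; case: eqP => [->|/eqP yx] /=; first by rewrite tpermR.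
case: eqP => [->|/eqP yax] /=; first by rewrite alK tpermL.
rewrite tpermD //; last by rewrite (inj_eq perm_inj) eq_sym.
by apply: contra_neq yax => ->; rewrite alK.
Qed.

Lemma remove_edgeK : involutive remove_edge.
Proof.
move=> y; rewrite (remove_edgeE y).
case: eqP => [->|/eqP yx] /=; first by rewrite remove_edgeE eqxx.
case: eqP => [->|/eqP yax] /=; first by rewrite remove_edgeE eqxx orbT.
rewrite remove_edgeE (inj_eq perm_inj) (negPf yx) orbF alK.
by rewrite ifF //; apply/negbTE; apply: contra_neq yax => <-; rewrite alK.
Qed.

Lemma remove_edge_mul : (remove_edge * tperm x (al x))%g = al.
Proof. by rewrite /remove_edge -mulgA tperm2 mulg1. Qed.

Lemma card_moved_remove_edge : #|moved al| = #|moved remove_edge|.+2.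
Proof.
rewrite (cardsD1 x) (cardsD1 (al x)) !inE alx alK eq_sym alx /=.
rewrite !add1n; congr (_.+2); apply: eq_card => y.
rewrite !inE remove_edgeE andbA; case: eqP => /= [->|_]; first by rewrite orbT eqxx.
by case: eqP => [->|] //=; rewrite ?eqxx.
Qed.

End RemoveEdge.

Lemma involution_tperms al : involutive al ->
  exists2 ts, al = tperms ts & 2 * size ts = #|moved al|.
Proof.
have [n] := ubnP #|moved al|; elim: n al => // n IHn al lt_n alK.
have [m0|[x]] := set_0Vmem (moved al).
  exists [::]; last by rewrite m0 cards0.
  rewrite /tperms big_nil; apply/permP => y; rewrite perm1; apply/eqP.
  by have /setP/(_ y) := m0; rewrite !inE; case: eqP.
rewrite inE => alx; have cm := card_moved_remove_edge alK alx.
have [|ts ets sz] := IHn (remove_edge al x) _ (remove_edgeK x alK).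
  by move: lt_n; rewrite cm; lia.
exists (rcons ts (x, al x)); last by rewrite cm -sz size_rcons; lia.
by rewrite /tperms big_rcons /= -/(tperms ts) -ets remove_edge_mul.
Qed.

End Genus.

(** The points on which [c] agrees with [c y] form a set that the group
    preserves. *)
Lemma transitive_invariant (T : finType) (S : eqType) (al sg : {perm T}) (c : T -> S) :
    [transitive <<[set al; sg]>>%g, on [set: T] | 'P] ->
    (forall x, c (al x) = c x) -> (forall x, c (sg x) = c x) ->
  forall x y, c x = c y.
Proof.
move=> tr cal csg x y; apply/eqP.
have act : [acts <<[set al; sg]>>%g, on [set z | c z == c y] | 'P].
  rewrite gen_subG; apply/subsetP => g; rewrite !inE => gA.
  apply/subsetP => z; rewrite !inE /= apermE.
  by case/orP: gA => /eqP ->; rewrite ?cal ?csg.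
have := acts_in_orbit act (x := y) (y := x); rewrite !inE; apply => //.
by rewrite (atransP tr) ?inE.
Qed.

(** In the genus inequality there is one component, [e + 1] vertices and [e]
    transpositions, which leaves at most one cycle for [al * sg]. *)
Lemma plane_tree_face (T : finType) e (al sg : {perm T}) :
  plane_tree e al sg -> forall x y, y \in porbit (al * sg)%g x.
Proof.
case/and4P => /eqP cT /forallP al_inv tr /eqP csg x y.
have alK : involutive al by move=> h; have /andP[_ /eqP] := al_inv h.
have [ts ets sz] := involution_tperms alK.
have mT : moved al = setT.
  by apply/setP => h; rewrite !inE; have /andP[] := al_inv h.
have [c [cs cp]] := genus_inequality ts sg; rewrite -ets in cp *.
have cal h : c (al h) = c h by rewrite -cs -permM cp.
have cc := transitive_invariant tr cal cs.
have : #|c @: T| <= 1.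
  rewrite -(cards1 (c x)); apply/subset_leq_card/subsetP => _ /imsetP[h _ ->].
  by rewrite inE (cc h x).
move: sz; rewrite mT cardsT cT csg => sz c1 le.
have p1 : #|porbits (al * sg)%g| <= 1 by lia.
rewrite -eq_porbit_mem; apply/eqP.
by apply: (card_le1_eqP p1); apply: imset_f.
Qed.

Lemma porbit_closed (T : finType) (s : {perm T}) (A : {pred T}) x y :
  {homo s : z / z \in A} -> x \in A -> y \in porbit s x -> y \in A.
Proof.
move=> sA xA /porbitP[i ->]; elim: i => [|i IHi]; first by rewrite perm1.
by rewrite expgSr permM sA.
Qed.

Definition rotation n : {perm 'I_n} := perm (@ordS_inj n).

Lemma rotationE n (i : 'I_n) : rotation n i = i.+1 %% n :> nat.
Proof. by rewrite permE. Qed.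

(** Edges commute, so any two of them can be made the last factors. *)
Lemma involution_split_edges (T : finType) (al : {perm T}) x y :
    involutive al -> al x != x -> al y != y -> y != x -> y != al x ->
  exists2 ts, al = (tperms ts * (tperm y (al y) * tperm x (al x)))%g
            & 2 * (size ts).+2 = #|moved al|.
Proof.
move=> alK alx aly yx yax; set al1 := remove_edge al x.
have al1y : al1 y = al y by rewrite remove_edgeE // (negPf yx) (negPf yax).
have al1K : involutive al1 by exact: remove_edgeK.
have [ts ets sz] := involution_tperms (remove_edgeK y al1K).
exists ts.
  by rewrite -ets mulgA -al1y remove_edge_mul remove_edge_mul.
rewrite (card_moved_remove_edge alK alx) -/al1.
by rewrite (card_moved_remove_edge (x := y) al1K) ?al1y // -sz; lia.
Qed.

Lemma rotationX n (i : 'I_n) k : (rotation n ^+ k)%g i = (i + k) %% n :> nat.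
Proof.
elim: k => [|k IHk]; first by rewrite perm1 addn0 modn_small.
by rewrite expgSr permM rotationE IHk -addn1 modnDml addn1 addnS.
Qed.

Lemma porbit_rotation n (i j : 'I_n) : j \in porbit (rotation n) i.
Proof.
apply/porbitP; exists (n - i + j); apply: val_inj => /=.
rewrite rotationX addnA subnKC 1?ltnW // modnDl modn_small //.
Qed.

Lemma card_porbits_rotation n : #|porbits (rotation n)| <= 1.
Proof.
apply/card_le1_eqP => _ _ /imsetP[i _ ->] /imsetP[j _ ->].
by apply/eqP; rewrite eq_porbit_mem porbit_rotation.
Qed.

(** Transposing [x] and its mate cuts the contour into two cycles, one of which
    consists of the positions in [x + 1 .. al x]. Were [y] and its mate in
    different cycles, the edge of [y] would merge them again, and the remaining
    [n / 2 - 2] edges could not produce the required number of cycles. *)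
Lemma noncrossing_cycles n (al : {perm 'I_n}) :
    involutive al -> (forall i, al i != i) ->
    n.+2 <= 2 * #|porbits (al * rotation n)%g| ->
  forall x y : 'I_n, x < y < al x -> x < al y < al x.
Proof.
move=> alK al_fp le_n x y /andP[xy yx].
have neq_yx : y != x by rewrite neq_ltn xy orbT.
have neq_yax : y != al x by rewrite neq_ltn yx.
have [ts ets sz] := involution_split_edges alK (al_fp x) (al_fp y) neq_yx neq_yax.
have mT : moved al = setT by apply/setP => h; rewrite !inE al_fp.
rewrite mT cardsT card_ord in sz.
pose s := (tperm x (al x) * rotation n)%g.
have mem_s : al y \in porbit s y.
  rewrite porbit_sym; apply: contraTT le_n => nmem; rewrite -ltnNge.
  have -> : (al * rotation n = tperms ts * (tperm y (al y) * s))%g.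
    by rewrite {1}ets /s !mulgA.
  have lt_s := card_porbits_tperm_merge nmem.
  have le_s : #|porbits s| <= _ := card_porbits_tperm x (al x) (rotation n).
  have le_p := card_porbits_tperms ts (tperm y (al y) * s)%g.
  have le_r := card_porbits_rotation n.
  apply: (@leq_ltn_trans (2 * (1 + size ts))); last by lia.
  rewrite leq_mul2l /=; apply: leq_trans le_p _; rewrite leq_add2r -ltnS.
  by apply: leq_trans lt_s _; apply: leq_trans le_s _.
have s_closed : {homo s : z / z \in [pred z : 'I_n | x < z <= al x]}.
  move=> z; rewrite !inE => /andP[xz zx]; rewrite permM.
  case: tpermP => [zx'|_|/eqP _ /eqP zax]; first by rewrite zx' ltnn in xz.
    by rewrite rotationE modn_small; have := ltn_ord (al x); lia.
  have {}zx : z < al x by rewrite ltn_neqAle zx andbT.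
  by rewrite rotationE modn_small; have := ltn_ord (al x); lia.
have := porbit_closed s_closed _ mem_s; rewrite !inE xy (ltnW yx) => /(_ isT).
case/andP => -> /=; rewrite leq_eqVlt => /orP[/eqP e|//].
by move/val_inj/perm_inj: e neq_yx => ->; rewrite eqxx.
Qed.

(** * Plane trees with a prescribed contour *)

(** The default value 1 is only taken when [n] is not the length of the word
    of [b]. *)
Definition matching n b : {perm 'I_n} :=
  odflt 1%g [pick s : {perm 'I_n} | [forall i, s i == mate b i :> nat]].

Lemma matchingE n b (i : 'I_n) : n = 2 * nodes b -> matching n b i = mate b i :> nat.
Proof.
move=> nb; rewrite /matching; case: pickP => [s /forallP/(_ i)/eqP // | no].
have lt_m (j : 'I_n) : mate b j < n by rewrite {2}nb mate_lt -nb.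
have m_inj : injective (fun j => Ordinal (lt_m j)).
  by move=> j k /(congr1 val) /= /(can_inj (mateK b)) /val_inj.
by have /negP[] := no (perm m_inj); apply/forallP => j; rewrite permE.
Qed.

Definition vertex_perm n b : {perm 'I_n} := (matching n b * rotation n)%g.

Lemma matchingK n b : n = 2 * nodes b -> involutive (matching n b).
Proof. by move=> nb i; apply: val_inj; rewrite /= !matchingE // mateK. Qed.

Lemma matching_neq n b i : n = 2 * nodes b -> matching n b i != i.
Proof.
move=> nb; rewrite -(inj_eq val_inj) /= matchingE //.
by apply: mate_neq; rewrite -nb.
Qed.

Definition ord_set n (c : seq nat) := [set i : 'I_n | val i \in c].

Lemma card_ord_set n c : uniq c -> {in c, forall i, i < n} -> #|ord_set n c| = size c.
Proof.
move=> uc cn; rewrite cardE -(size_map val); apply: perm_size.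
apply: uniq_perm => // [|i]; first by rewrite map_inj_uniq ?enum_uniq //; apply: val_inj.
apply/mapP/idP => [[j + ->]|ic]; first by rewrite mem_enum inE.
by exists (Ordinal (cn i ic)); rewrite // mem_enum inE.
Qed.

(** Along the cycle [c], started at [x], the iterates of [s] on [x] run through
    [c], with period the length of [c]. *)
Lemma porbit_fcycle n (s : {perm 'I_n}) (f : nat -> nat) (c : seq nat) (x : 'I_n) :
    (forall i : 'I_n, f i = s i) -> uniq c -> fcycle f c -> val x \in c ->
  porbit s x = ord_set n c.
Proof.
move=> fs uc cyc xc; have fsX k : iter k f x = (s ^+ k)%g x :> nat.
  by elim: k => [|k IHk]; rewrite ?perm1 // iterS IHk fs expgSr permM.
have [i p ec] := rot_to xc.
move: cyc; rewrite -(rot_cycle i) ec /= => /fpathP[k ep].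
apply/setP => y; rewrite inE -(mem_rot i) ec.
apply/porbitP/idP => [[j ->] | yp].
  have [m lt_m e] : exists2 m, m <= k & (s ^+ j)%g x = (s ^+ m)%g x.
    have k0 : 0 < k by case: k ep => //; case: p {ec}.
    have per : (s ^+ k)%g x = x.
      apply: val_inj; rewrite -[RHS](last_rcons (val x) p (val x)) ep last_traject.
      by case: k {ep} k0 => // k _; rewrite -iterSr fsX.
    exists (j %% k); first by rewrite ltnW // ltn_pmod.
    rewrite {1}(divn_eq j k) expgD permM; congr (_ _).
    elim: (j %/ k) => [|m IHm]; first by rewrite perm1.
    by rewrite mulSn expgD permM per.
  rewrite e /= -fsX; case: m lt_m {e} => [|m] lt_m; first exact: mem_head.
  have : iter m.+1 f x \in rcons p x by rewrite ep iterSr; apply/trajectP; exists m.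
  by rewrite mem_rcons.
have {yp} : val y \in rcons p (val x) by rewrite mem_rcons.
rewrite ep => /trajectP[j _]; rewrite -iterSr fsX => e.
by exists j.+1; apply: val_inj.
Qed.

Lemma nil_other_cycles b : [::] \notin other_cycles b.
Proof.
elim: b => //= l IHl r IHr; rewrite in_cons mem_cat /= negb_or.
by apply/andP; split; apply/negP => /mapP[[|x c]] // h _; [move: IHl|move: IHr]; rewrite h.
Qed.

Lemma uniq_ord_sets n (ss : seq (seq nat)) :
    uniq (flatten ss) -> [::] \notin ss -> {in flatten ss, forall i, i < n} ->
  uniq (map (ord_set n) ss).
Proof.
elim: ss => //= c ss IHss; rewrite cat_uniq in_cons negb_or eq_sym.
move=> /and3P[uc dis us] /andP[c0 ss0] lt_n; rewrite IHss //; last first.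
  by move=> i iss; apply: lt_n; rewrite mem_cat iss orbT.
rewrite andbT; apply/negP => /mapP[c' c'ss].
case: c c0 uc dis lt_n => // x c _ _ dis lt_n /setP.
have lt_x : x < n by apply: lt_n; rewrite mem_head.
move=> /(_ (Ordinal lt_x)); rewrite !inE eqxx /= => /esym xc'.
move/negP: dis; apply; apply/hasP; exists x; last exact: mem_head.
by apply/flattenP; exists c'.
Qed.

Section VertexCycles.
Variables (n : nat) (b : bintree).
Hypotheses (nb : n = 2 * nodes b) (n_gt0 : 0 < n).

Let f i := step b i %% n.

Lemma vertex_permE (i : 'I_n) : f i = vertex_perm n b i.
Proof. by rewrite permM rotationE matchingE. Qed.

Lemma flatten_cycles_uniq : uniq (flatten (root_cycle b :: other_cycles b)).
Proof. by rewrite (perm_uniq (perm_cycles b)) iota_uniq. Qed.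

Lemma mem_flatten_cycles i : (i \in flatten (root_cycle b :: other_cycles b)) = (i < n).
Proof. by rewrite (perm_mem (perm_cycles b)) mem_iota nb. Qed.

(** Reducing modulo [n] identifies the exit value with position 0. *)
Lemma step_rel_mod i j : step_rel b i j -> frel f (i %% n) (j %% n).
Proof. by case/andP => lt_i /eqP <- /=; rewrite modn_small // nb. Qed.

Lemma root_cycle_fcycle : fcycle f (root_cycle b).
Proof.
have [s] := root_cycleP b.
have small : {in root_cycle b, forall i, i %% n = i}.
  by move=> i ic; rewrite modn_small // -mem_flatten_cycles mem_cat ic.
case: (root_cycle b) small => [|x c] // small [x0 es] ps.
have -> : x :: c = map (modn^~ n) (x :: c) by rewrite map_id_in.
rewrite -es -nb in ps; have := @homo_path _ _ (modn^~ n) _ (frel f) _ _ step_rel_mod ps.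
by rewrite map_rcons modnn mod0n x0 /= mod0n.
Qed.

Lemma other_cycles_fcycle c : c \in other_cycles b -> fcycle f c.
Proof.
move=> cb; have -> : c = map (modn^~ n) c.
  rewrite map_id_in // => i ic; rewrite modn_small // -mem_flatten_cycles mem_cat.
  by apply/orP; right; apply/flattenP; exists c.
exact: (@homo_cycle _ _ (modn^~ n) _ (frel f) step_rel_mod _ (other_cyclesP cb)).
Qed.

Lemma mem0_root_cycle : 0 \in root_cycle b.
Proof. by move: nb n_gt0; case: b => [->|]. Qed.

Lemma porbit_cycles c x : c \in root_cycle b :: other_cycles b -> val x \in c ->
  porbit (vertex_perm n b) x = ord_set n c.
Proof.
move=> cb xc; apply: (porbit_fcycle vertex_permE) => //.
  have := flatten_cycles_uniq; elim: (_ :: _) cb => //= c' ss IHss.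
  rewrite in_cons cat_uniq => /orP[/eqP->|css] /and3P[] // _ _; exact: IHss.
move: cb; rewrite in_cons => /orP[/eqP->|]; first exact: root_cycle_fcycle.
exact: other_cycles_fcycle.
Qed.

Lemma porbits_vertex_perm :
  uniq (map (ord_set n) (root_cycle b :: other_cycles b)) /\
  porbits (vertex_perm n b) =i map (ord_set n) (root_cycle b :: other_cycles b).
Proof.
have nil_b : [::] \notin root_cycle b :: other_cycles b.
  rewrite in_cons negb_or nil_other_cycles andbT.
  by have := mem0_root_cycle; case: (root_cycle b).
split.
  apply: uniq_ord_sets; [exact: flatten_cycles_uniq|exact: nil_b|].
  by move=> i; rewrite mem_flatten_cycles.
move=> C; apply/imsetP/mapP => [[x _ ->]|[c cb ->]].
  have /flattenP[c cb xc] : val x \in flatten (root_cycle b :: other_cycles b).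
    by rewrite mem_flatten_cycles ltn_ord.
  by exists c => //; apply: porbit_cycles.
case: c cb => [|i c] cb; first by rewrite cb in nil_b.
have lt_i : i < n.
  by rewrite -mem_flatten_cycles; apply/flattenP; exists (i :: c); rewrite ?mem_head.
by exists (Ordinal lt_i); rewrite // (porbit_cycles cb) // mem_head.
Qed.

Lemma card_porbits_vertex_perm : #|porbits (vertex_perm n b)| = (nodes b).+1.
Proof.
have [up ep] := porbits_vertex_perm.
by rewrite (eq_card ep) (card_uniqP up) size_map /= size_other_cycles.
Qed.

Lemma card_cycles c : c \in root_cycle b :: other_cycles b -> #|ord_set n c| = size c.
Proof.
move=> cb; apply: card_ord_set => [|i ic].
  have := flatten_cycles_uniq; elim: (_ :: _) cb => //= c' ss IHss.
  rewrite in_cons cat_uniq => /orP[/eqP->|css] /and3P[] // _ _; exact: IHss.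
by rewrite -mem_flatten_cycles; apply/flattenP; exists c.
Qed.

End VertexCycles.

Lemma transitive_rotation n (al sg : {perm 'I_n}) :
    0 < n -> (al * sg)%g = rotation n ->
  [transitive <<[set al; sg]>>%g, on [set: 'I_n] | 'P].
Proof.
move=> n0 face; apply/imsetP; exists (Ordinal n0); rewrite ?inE //.
apply/setP => j; rewrite inE; apply/esym/orbitP.
have /porbitP[k ->] := porbit_rotation (Ordinal n0) j.
exists (rotation n ^+ k)%g; rewrite ?apermE //.
by rewrite -face groupX // groupM // mem_gen // !inE eqxx ?orbT.
Qed.

(** Since [sg = al * rotation n], such a pair is determined by [al], a noncrossing
    involution, which [noncrossing_mate] turns into a binary tree. *)
Lemma plane_tree_rotation n e (al sg : {perm 'I_n}) : 0 < e -> n = 2 * e ->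
  reflect (exists2 b, b \in trees e & (al, sg) = (matching n b, vertex_perm n b))
    (plane_tree e al sg && (al * sg == rotation n)%g).
Proof.
move=> e0 ne; apply: (iffP andP) => [[/and4P[_ /forallP al_inv tr cs] /eqP face]|]; last first.
  case=> b; rewrite mem_trees => /eqP be [-> ->]; rewrite -be in ne.
  have n0 : 0 < n by lia.
  have mK := matchingK ne.
  have mul_m : (matching n b * vertex_perm n b)%g = rotation n.
    by apply/permP => i; rewrite !permM mK.
  split; last by rewrite mul_m.
  apply/and4P; split.
  - by rewrite card_ord ne be.
  - by apply/forallP => h; rewrite matching_neq //= mK.
  - exact: transitive_rotation.
  - by rewrite card_porbits_vertex_perm // be.
have alK : involutive al by move=> h; have /andP[_ /eqP] := al_inv h.
have alN h : al h != h by have /andP[] := al_inv h.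
have sgE : sg = (al * rotation n)%g.
  by apply/permP => h; rewrite -face !permM alK.
have nc := noncrossing_cycles alK alN; rewrite -sgE (eqP cs) in nc.
have {}nc := nc ltac:(lia).
(* [noncrossing_mate] is about functions on [nat]; [al] is extended by the
   identity. *)
pose g i := if insub i is Some h then val (al h : 'I_n) else i.
have gE (h : 'I_n) : g h = al h by rewrite /g valK.
have [] := @noncrossing_mate g 0 n (leq0n n).
- by move=> i /= lt_i; rewrite (gE (Ordinal lt_i)) /=.
- move=> i /= lt_i; rewrite (gE (Ordinal lt_i)) gE alK; split => //.
  by have := alN (Ordinal lt_i); rewrite -(inj_eq val_inj).
- move=> a c _ ac lt_ga; case/andP: ac => ac cga.
  have lt_a : a < n by lia.
  have lt_c : c < n by lia.
  rewrite (gE (Ordinal lt_a)) (gE (Ordinal lt_c)) in cga *.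
  by apply: (nc (Ordinal lt_a) (Ordinal lt_c)); rewrite /= ac.
move=> b; rewrite add0n => nb gb; exists b; first by rewrite mem_trees; lia.
have am : al = matching n b.
  apply/permP => i; apply: val_inj; rewrite /= matchingE // -gE.
  by have := gb i; rewrite !add0n => -> //; rewrite -nb.
by rewrite sgE am.
Qed.

Lemma matching_inj n e b b' : n = 2 * e -> b \in trees e -> b' \in trees e ->
  matching n b = matching n b' -> b = b'.
Proof.
rewrite !mem_trees => ne /eqP be /eqP be' /permP m.
apply: mate_inj => [|i lt_i]; first by rewrite be be'.
have lt_in : i < n by lia.
have := congr1 val (m (Ordinal lt_in)).
by rewrite /= !matchingE ?be ?be'.
Qed.

Import GRing.Theory.
Local Open Scope ring_scope.

(** * Placing labelled half-edges on the vertices *)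

Section Placements.
Variables (I : finType) (A : comNzRingType) (x : I -> A).
Implicit Types (S : {set I}) (ms : seq nat) (vs : seq I).

(** The weight of putting label [k] on one of the half-edges of a vertex of
    degree [m]. *)
Definition place1 (k : I) (m : nat) : A := m%:R * x k ^+ m.

(** The weighted count of the ways to attach the labels in [S] to half-edges of
    distinct vertices, the degrees of the vertices being [ms]: the coefficient of
    [prod_(k in S) y_k] in [prod_(m in ms) (1 + sum_k m x_k^m y_k)]. *)
Fixpoint place ms S : A :=
  if ms is m :: ms' then
    place ms' S + \sum_(k in S) place1 k m * place ms' (S :\ k)
  else (S == set0)%:R.

(** Each label goes to a vertex of the first list or to one of the second. *)
Lemma place_cat ms1 ms2 S :
  place (ms1 ++ ms2) S =
  \sum_(IJ : {set I} * {set I} | (IJ.1 :|: IJ.2 == S) && (IJ.1 :&: IJ.2 == set0))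
    place ms1 IJ.1 * place ms2 IJ.2.
Proof.
elim: ms1 S => [|m ms1 IHms] S /=.
  rewrite (bigD1 (set0, S)) /= ?set0U ?set0I ?eqxx // mul1r.
  rewrite big1 ?addr0 // => -[X Y] /= /andP[/andP[/eqP <- _]].
  by case: (X =P set0) => [->|]; rewrite ?set0U ?eqxx // mul0r.
rewrite IHms; under [RHS]eq_bigr do rewrite mulrDl.
rewrite big_split /=; congr (_ + _).
under [RHS]eq_bigr do rewrite big_distrl /=.
rewrite (exchange_big_dep (mem S)) /=; last first.
  by move=> [X Y] k /andP[/eqP <- _] /= kX; rewrite inE kX.
apply: eq_bigr => k kS; rewrite IHms big_distrr /=.
rewrite [RHS](reindex_onto (fun XY : {set I} * {set I} => (k |: XY.1, XY.2))
   (fun XY => (XY.1 :\ k, XY.2))) /=; last first.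
  by move=> [X Y] /= /andP[_ kX]; rewrite setD1K.
apply: eq_big => [[X Y]|[X Y] /andP[/eqP /= e _]] /=; last first.
  rewrite -mulrA setU1K //; apply/negP => kX.
  by have := setD11 k S; rewrite -e inE kX.
rewrite setU11 andbT xpair_eqE eqxx andbT -setUA.
have [kX|kX] := boolP (k \in X).
  have -> : (X :|: Y == S :\ k) = false.
    by apply/negP => /eqP e; have := setD11 k S; rewrite -e inE kX.
  have -> : ((k |: X) :\ k == X) = false; last by rewrite andbF.
  by apply/negP => /eqP e; have := setD11 k (k |: X); rewrite e kX.
rewrite setU1K // eqxx andbT.
have [kY|kY] := boolP (k \in Y).
  have -> : (X :|: Y == S :\ k) = false.
    by apply/negP => /eqP e; have := setD11 k S; rewrite -e inE kY orbT.
  have -> : ((k |: X) :&: Y == set0) = false; last by rewrite andbF.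
  by apply/negP => /eqP/setP/(_ k); rewrite !inE eqxx kY.
rewrite setIUl (_ : [set k] :&: Y = set0); last first.
  by apply/setP => i; rewrite !inE; case: eqP => // ->; rewrite (negPf kY).
rewrite set0U; congr (_ && _).
have kXY : k \notin X :|: Y by rewrite inE negb_or kX.
by apply/eqP/eqP => [->|<-]; rewrite ?setD1K // setU1K.
Qed.

(** The expansion along a label instead of a vertex: [C] is the vertex that
    receives [v]. *)
Lemma place_label (T : eqType) (f : T -> nat) (cs : seq T) v S :
    uniq cs -> v \notin S ->
  place (map f cs) (v |: S) =
  \sum_(C <- cs) place1 v (f C) * place (map f (rem C cs)) S.
Proof.
elim: cs S => [|a cs IHcs] S /= ucs vS.
  rewrite big_nil; case: eqP => // /setP/(_ v).
  by rewrite !inE eqxx.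
have /andP[acs {}ucs] := ucs; rewrite IHcs // big_cons eqxx.
rewrite big_setU1 //= setU1K // addrCA; congr (_ + _).
rewrite (eq_bigr (fun k => \sum_(C <- cs)
    place1 v (f C) * (place1 k (f a) * place (map f (rem C cs)) (S :\ k)))); last first.
  move=> k kS; have kv : k != v by apply: contraNneq vS => <-.
  rewrite (_ : (v |: S) :\ k = v |: (S :\ k)); last first.
    by apply/setP => i; rewrite !inE; case: (i =P v) => [->|]; rewrite // eq_sym kv.
  rewrite IHcs ?inE ?(negPf vS) ?andbF // big_distrr /=.
  by apply: eq_bigr => C _; rewrite mulrCA.
rewrite exchange_big -big_split /= big_seq [RHS]big_seq.
apply: eq_bigr => C Ccs; rewrite -big_distrr -mulrDr /=.
by rewrite ifN //; apply: contraNneq acs => ->.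
Qed.

Lemma big_tuple_cons (R : nmodType) (H : finType) n (P : pred (n.+1.-tuple H))
    (F : n.+1.-tuple H -> R) :
  \sum_(r | P r) F r = \sum_h \sum_(r : n.-tuple H | P [tuple of h :: r]) F [tuple of h :: r].
Proof.
rewrite pair_big_dep /=.
rewrite (reindex (fun p : H * n.-tuple H => [tuple of p.1 :: p.2])) //=.
exists (fun r => (thead r, [tuple of behead r])) => [[h r] _|r _] /=.
  by congr pair; apply: val_inj.
by rewrite [RHS]tuple_eta.
Qed.

Lemma big_tuple_rcons (R : nmodType) (H : finType) n (P : pred (n.+1.-tuple H))
    (F : n.+1.-tuple H -> R) :
  \sum_(r | P r) F r =
  \sum_(r : n.-tuple H) \sum_(h | P [tuple of rcons r h]) F [tuple of rcons r h].
Proof.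
rewrite pair_big_dep /=.
rewrite (reindex (fun p : n.-tuple H * H => [tuple of rcons p.1 p.2])) //=.
exists (fun r => ([tuple of belast (thead r) (behead r)], last (thead r) (behead r))).
  move=> [r h] _ /=; set t := [tuple of rcons r h].
  have e : thead t :: behead t = rcons r h by rewrite -[RHS]/(val t) [in RHS](tuple_eta t).
  have := lastI (thead t) (behead t); rewrite e => /rcons_inj[er eh].
  by congr pair; [apply: val_inj | ].
by move=> r _; apply: val_inj; rewrite /= -lastI [in RHS](tuple_eta r).
Qed.

Variables (H : finType) (sg : {perm H}).

(** When [r] is longer than [vs], its last entries have weight 1; they are the
    roots whose degree is not recorded. *)
Definition degree_weight vs (r : seq H) : A :=
  \prod_(p <- zip vs r) x p.1 ^+ #|porbit sg p.2|.

Lemma degree_weight_rcons vs (r : seq H) h : (size vs <= size r)%N ->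
  degree_weight vs (rcons r h) = degree_weight vs r.
Proof.
move=> le_r; rewrite /degree_weight; congr (\big[_/_]_(_ <- _) _).
by elim: vs r le_r => [|v vs IHvs] [|h' r] //= le_r; rewrite IHvs.
Qed.

Lemma sum_porbits (R : nmodType) (cs : seq {set H}) (F : {set H} -> R) :
    uniq cs -> {subset cs <= porbits sg} ->
  \sum_(h | porbit sg h \in cs) F (porbit sg h) = \sum_(C <- cs) F C *+ #|C|.
Proof.
move=> ucs cs_sg; rewrite (partition_big (porbit sg) (mem cs)) //= big_uniq //=.
apply: eq_bigr => C Ccs; have /imsetP[h0 _ C0] := cs_sg C Ccs.
rewrite (eq_bigr (fun=> F C)) => [|h /andP[_ /eqP ->] //].
rewrite sumr_const; congr (_ *+ _); apply: eq_card => h; rewrite unfold_in /= C0.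
by rewrite -(eq_porbit_mem sg h h0) andb_idl // => /eqP ->; rewrite -C0.
Qed.

(** Choosing the half-edges one label after the other: the first label takes any
    of the [#|C|] half-edges of a vertex [C], and the others avoid [C]. *)
Lemma sum_tuples_place vs (cs : seq {set H}) :
    uniq vs -> uniq cs -> {subset cs <= porbits sg} ->
  \sum_(r : (size vs).-tuple H |
        uniq (map (porbit sg) r) && all (mem cs) (map (porbit sg) r))
    degree_weight vs r =
  place (map (fun C : {set H} => #|C|) cs) [set v in vs].
Proof.
elim: vs cs => [|v vs IHvs] cs /= uvs ucs cs_sg.
  rewrite (bigD1 [tuple]) //= big1 ?addr0 => [|r]; last by rewrite [r]tuple0 (eqxx [tuple]) andbF.
  rewrite /degree_weight big_nil (_ : [set v in [::]] = set0); last first.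
    by apply/setP => i; rewrite !inE.
  have : forall S, S = set0 -> place (map (fun C : {set H} => #|C|) cs) S = 1.
    elim: (cs) => [|C cs' IHcs] S /= ->; first by rewrite eqxx.
    by rewrite IHcs // big_set0 addr0.
  by move=> ->.
have /andP[vvs {}uvs] := uvs.
rewrite set_cons place_label // ?inE // big_tuple_cons.
rewrite (bigID (fun h => porbit sg h \in cs)) /= [X in _ + X]big1 ?addr0; last first.
  by move=> h hcs; rewrite big_pred0 // => r; rewrite (negPf hcs) andbF.
pose F (C : {set H}) := x v ^+ #|C| * place (map (fun C : {set H} => #|C|) (rem C cs)) [set v in vs].
transitivity (\sum_(h | porbit sg h \in cs) F (porbit sg h)); last first.
  by rewrite sum_porbits //; apply: eq_bigr => C _; rewrite -mulr_natl mulrA.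
apply: eq_bigr => h hcs; rewrite /F -IHvs ?rem_uniq //; last first.
  by move=> C' /mem_rem; apply: cs_sg.
rewrite big_distrr /=; apply: eq_big => [r|r _]; last first.
  by rewrite /degree_weight /= big_cons.
rewrite hcs /= -andbA andbCA; congr (_ && _).
rewrite -has_pred1 -all_predC -all_predI /=; apply: eq_all => C' /=.
by rewrite mem_rem_uniq // inE.
Qed.

End Placements.

(** * Isomorphism classes and their canonical representatives *)

Lemma rtree_isoP (H : finType) N al sg (r : N.-tuple H) al' sg' (r' : N.-tuple H) :
  reflect (exists phi : {perm H}, [/\ (al ^ phi)%g = al', (sg ^ phi)%g = sg'
             & forall k, phi (tnth r k) = tnth r' k])
          (rtree_iso (al, sg, r) (al', sg', r')).
Proof.
apply: (iffP existsP) => -[phi].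
  case/and3P => /forallP ha /forallP hs /forallP hr; exists phi.
  split=> [||k]; last exact/eqP.
    by apply/permP => y; rewrite -(permKV phi y) permJ; apply/eqP.
  by apply/permP => y; rewrite -(permKV phi y) permJ; apply/eqP.
case=> <- <- hr; exists phi; apply/and3P; split; apply/forallP => h.
- by rewrite permJ.
- by rewrite permJ.
- by rewrite hr.
Qed.

Lemma rtree_iso_refl (H : finType) N : reflexive (@rtree_iso H N).
Proof.
move=> [[al sg] r]; apply/rtree_isoP; exists 1%g; rewrite !conjg1.
by split=> // k; rewrite perm1.
Qed.

Lemma rtree_iso_sym (H : finType) N : ssrbool.symmetric (@rtree_iso H N).
Proof.
suff h G G' : @rtree_iso H N G G' -> rtree_iso G' G.
  by move=> G G'; apply/idP/idP; apply: h.
move: G G' => [[al sg] r] [[al' sg'] r'] /rtree_isoP[phi [<- <- hr]].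
apply/rtree_isoP; exists (phi^-1)%g; rewrite !conjgK; split=> // k.
by rewrite -hr permK.
Qed.

Lemma rtree_iso_trans (H : finType) N : ssrbool.transitive (@rtree_iso H N).
Proof.
move=> [[al' sg'] r'] [[al sg] r] [[al2 sg2] r2].
case/rtree_isoP => phi [<- <- hr] /rtree_isoP[psi [<- <- hr']].
apply/rtree_isoP; exists (phi * psi)%g; rewrite !conjgM; split=> // k.
by rewrite permM hr hr'.
Qed.

Lemma porbitJ (H : finType) (s phi : {perm H}) x :
  porbit (s ^ phi)%g (phi x) = phi @: porbit s x.
Proof.
apply/setP => y; apply/porbitP/imsetP => [[i ->]|[z /porbitP[i ->] ->]].
  by exists ((s ^+ i)%g x); rewrite ?mem_porbit // -conjXg permJ.
by exists i; rewrite -conjXg permJ.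
Qed.

Lemma card_porbitJ (H : finType) (s phi : {perm H}) x :
  #|porbit (s ^ phi)%g (phi x)| = #|porbit s x|.
Proof. by rewrite porbitJ card_imset //; apply: perm_inj. Qed.

Lemma porbitsJ (H : finType) (s phi : {perm H}) :
  porbits (s ^ phi)%g = (fun C : {set H} => phi @: C) @: porbits s.
Proof.
apply/setP => C; apply/imsetP/imsetP => [[x _ ->]|[_ /imsetP[x _ ->] ->]].
  exists (porbit s ((phi^-1)%g x)); first exact: imset_f.
  by rewrite -porbitJ permKV.
by exists (phi x); rewrite ?porbitJ.
Qed.

(** The relabelling sends the point reached from [h] after [i] steps of [f]
    to [i]. *)
Lemma conj_to_rotation n (f : {perm 'I_n}) (h o : 'I_n) :
    (forall y, y \in porbit f h) -> o = 0%N :> nat ->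
  exists2 phi : {perm 'I_n}, (f ^ phi)%g = rotation n & phi h = o.
Proof.
move=> fh o0; pose g (i : 'I_n) := (f ^+ i)%g h.
have ch : #|porbit f h| = n.
  by rewrite (eq_card (B := 'I_n)) ?card_ord // => y; rewrite fh.
have g_inj : injective g.
  move=> i j; rewrite /g !permX => e; apply: val_inj.
  have := uniq_traject_porbit f h; rewrite ch => /(nth_uniq h).
  by move=> /(_ i j); rewrite !size_traject !ltn_ord !nth_traject // e eqxx => /(_ isT isT)/esym/eqP.
exists (perm g_inj)^-1%g.
  apply/permP => i; rewrite conjgE invgK !permM -[RHS](permK (perm g_inj)).
  congr (_ _); rewrite (permE g_inj i) (permE g_inj (rotation n i)) /g rotationE -permM -expgSr.
  have [e|ne] := eqVneq i.+1 n.
    by rewrite e modnn perm1 permX -[X in iter X]ch iter_porbit.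
  by rewrite modn_small // ltn_neqAle ne ltn_ord.
by apply: (canLR (permK _)); rewrite permE /g o0 perm1.
Qed.

Section Canonical.
Variables (e M : nat) (i0 : 'I_M).
Hypothesis e_gt0 : (0 < e)%N.
Local Notation n := (2 * e)%N.
Local Notation rooted := ({perm 'I_n} * {perm 'I_n} * M.-tuple 'I_n)%type.

Definition canonical (G : rooted) :=
  let: (al, sg, r) := G in
  ((al * sg)%g == rotation n) && (tnth r i0 == 0%N :> nat).

(** An isomorphism between canonical trees commutes with the rotation and fixes
    0, so it is the identity. *)
Lemma canonical_inj (G G' : rooted) :
  canonical G -> canonical G' -> rtree_iso G G' -> G = G'.
Proof.
move: G G' => [[al sg] r] [[al' sg'] r'] /andP[/eqP f /eqP o].
case/andP => /eqP f' /eqP o' /rtree_isoP[phi [ha hs hr]].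
have phi1 : phi = 1%g.
  have rJ : (rotation n ^ phi)%g = rotation n by rewrite -{1}f conjMg ha hs.
  have fix0 : phi (tnth r i0) = tnth r i0 by rewrite hr; apply: val_inj; rewrite /= o o'.
  apply/permP => x; have /porbitP[k ->] := porbit_rotation (tnth r i0) x.
  by rewrite perm1 -[in LHS]permJ conjXg rJ fix0.
rewrite -ha -hs phi1 !conjg1; congr pair.
by apply: eq_from_tnth => k; rewrite -hr phi1 perm1.
Qed.

(** The contour is a single cycle, so it can be numbered from the chosen root. *)
Lemma canonical_exists (s : nat) (d : 'I_s -> nat) (G : rooted) :
    rooted_tree e G -> root_degrees d G ->
  exists G' : rooted, [/\ rooted_tree e G', root_degrees d G', canonical G' & rtree_iso G G'].
Proof.
move: G => [[al sg] r] /andP[pt ur] dr.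
have n0 : (0 < n)%N by lia.
have face := plane_tree_face pt (tnth r i0).
have [phi fr h0] := @conj_to_rotation n _ _ (Ordinal n0) face erefl.
rewrite conjMg in fr.
exists ((al ^ phi)%g, (sg ^ phi)%g, [tuple phi (tnth r k) | k < M]); split.
- apply/andP; split.
    case/and4P: pt => cn /forallP al_inv _ /eqP cs; apply/and4P; split=> //.
    + apply/forallP => h; rewrite -(permKV phi h) !permJ !(inj_eq perm_inj).
      exact: al_inv.
    + exact: transitive_rotation.
    + rewrite porbitsJ card_imset ?cs //; exact: imset_inj perm_inj.
  have -> : [seq porbit (sg ^ phi)%g h | h <- [tuple phi (tnth r k) | k < M]] =
      map (fun C : {set _} => phi @: C) [seq porbit sg h | h <- r].
    rewrite -map_comp /= -[in RHS](map_tnth_enum r) -!map_comp.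
    by apply: eq_map => k /=; rewrite porbitJ.
  by rewrite map_inj_uniq //; apply: imset_inj perm_inj.
- apply/forallP => j; have /existsP[k /andP[kj dk]] := forallP dr j.
  by apply/existsP; exists k; rewrite kj /= tnth_mktuple /vertex_degree card_porbitJ.
- by rewrite /canonical fr eqxx tnth_mktuple h0.
- by apply/rtree_isoP; exists phi; split=> // k; rewrite tnth_mktuple.
Qed.

(** Any of the [M] roots may serve as the origin [i0] of the contour; the
    recursion needs both the first and the last one. *)
Lemma num_trees_canonical (s : nat) (d : 'I_s -> nat) :
  num_trees M e d =
  #|[set G : rooted | [&& rooted_tree e G, canonical G & root_degrees d G]]|.
Proof.
rewrite /num_trees (negPf (lt0n_neq0 e_gt0)).
set D := [set G | _]; set C := [set G | _].
pose cl G := [set G' in D | rtree_iso G G'].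
have -> : equivalence_partition (@rtree_iso 'I_n M) D = cl @: C.
  apply/setP => X; apply/imsetP/imsetP => -[G GD ->].
    move: GD; rewrite inE => /andP[rG dG].
    have [G' [rG' dG' cG' iG]] := canonical_exists rG dG.
    exists G'; first by rewrite inE rG' dG' cG'.
    apply/setP => G2; rewrite !inE; congr (_ && _); apply/idP/idP.
      by apply: rtree_iso_trans; rewrite rtree_iso_sym.
    exact: rtree_iso_trans.
  by exists G => //; move: GD; rewrite !inE => /and3P[-> _ ->].
apply: card_in_imset => G G'; rewrite !inE => /and3P[rG cG dG] /and3P[rG' cG' dG'].
move/setP/(_ G'); rewrite !inE rG' dG' rtree_iso_refl /= => iG.
exact: canonical_inj.
Qed.

End Canonical.

(** * From isomorphism classes to sums over binary trees *)

Section Expansion.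
Variables (I : finType) (A : comNzRingType) (x : I -> A).

Lemma degree_weight_tnth (H : finType) (sg : {perm H}) s M (hs : (s <= M)%N)
    (vs : s.-tuple I) (r : M.-tuple H) :
  degree_weight x sg vs r =
  \prod_(j < s) x (tnth vs j) ^+ #|porbit sg (tnth r (widen_ord hs j))|.
Proof.
rewrite /degree_weight; case: s hs vs => [|s] hs vs.
  by rewrite big_ord0 (@size0nil _ (zip vs r)) ?big_nil // size_zip size_tuple min0n.
pose p0 := (tnth vs ord0, tnth r (widen_ord hs ord0)).
rewrite (big_nth p0) size_zip !size_tuple (minn_idPl hs) big_mkord.
apply: eq_bigr => j _; rewrite nth_zip_cond size_zip !size_tuple (minn_idPl hs) ltn_ord /=.
by rewrite -!tnth_nth -(tnth_nth _ r (widen_ord hs j)).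
Qed.

(** A canonical tree is a binary tree together with its tuple of roots, and the
    sum over [d] is reduced to the degrees of these roots. *)
Lemma sum_num_trees e s M (i0 : 'I_M) (vs : s.-tuple I) : (0 < e)%N -> (s <= M)%N ->
  \sum_(d : {ffun 'I_s -> 'I_(2 * e).+1})
     (\prod_j x (tnth vs j) ^+ d j) *+ num_trees M e (fun j => d j : nat) =
  \sum_(b <- trees e)
    \sum_(r : M.-tuple 'I_(2 * e) |
            uniq (map (porbit (vertex_perm (2 * e) b)) r) && (tnth r i0 == 0%N :> nat))
      degree_weight x (vertex_perm (2 * e) b) vs r.
Proof.
move=> e0 hs; set n := (2 * e)%N.
pose w (G : {perm 'I_n} * {perm 'I_n} * M.-tuple 'I_n) := degree_weight x G.1.2 vs G.2.
transitivity (\sum_(G | rooted_tree e G && canonical i0 G) w G).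
  transitivity (\sum_(d : {ffun 'I_s -> 'I_n.+1})
      \sum_(G | [&& rooted_tree e G, canonical i0 G & root_degrees (fun j => d j : nat) G])
         w G).
    apply: eq_bigr => d _; rewrite (num_trees_canonical i0) // -sumr_const.
    apply: eq_big => [G|G]; rewrite ?inE // => /and3P[_ _].
    case: G => [[al sg] r] /forallP dr; rewrite /w (degree_weight_tnth _ hs) /=.
    apply: eq_bigr => j _; have /existsP[k /andP[/eqP kj /eqP <-]] := dr j.
    by rewrite (_ : widen_ord hs j = k) //; apply: val_inj.
  rewrite (exchange_big_dep (fun G => rooted_tree e G && canonical i0 G)) /=; last first.
    by move=> d G _ /and3P[-> ->].
  apply: eq_bigr => -[[al sg] r] GP.
  have lt_d j : (vertex_degree sg (tnth r (widen_ord hs j)) < n.+1)%N.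
    by rewrite ltnS -[X in (_ <= X)%N]card_ord max_card.
  rewrite (big_pred1 [ffun j => Ordinal (lt_d j)]) // => d.
  case/andP: GP => -> -> /=; apply/forallP/eqP => [dr|-> j].
    apply/ffunP => j; apply: val_inj; rewrite ffunE /=.
    have /existsP[k /andP[/eqP kj /eqP <-]] := dr j.
    by rewrite (_ : widen_ord hs j = k) //; apply: val_inj.
  by apply/existsP; exists (widen_ord hs j); rewrite ffunE /= !eqxx.
pose tree_pair b := (matching n b, vertex_perm n b).
have pe : perm_eq [seq tree_pair b | b <- trees e]
    [seq p <- index_enum ({perm 'I_n} * {perm 'I_n})%type |
       plane_tree e p.1 p.2 && ((p.1 * p.2)%g == rotation n)].
  apply: uniq_perm; last 1 first.
  - move=> [al sg]; rewrite mem_filter mem_index_enum andbT /=.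
    apply/mapP/idP => [h|/(plane_tree_rotation al sg e0 erefl)[b bt ->]]; last by exists b.
    apply/(plane_tree_rotation al sg e0 erefl); case: h => b bt ->; by exists b.
  - rewrite map_inj_in_uniq ?trees_uniq // => b b' bt bt' [em _].
    exact: matching_inj bt bt' em.
  - by rewrite filter_uniq // index_enum_uniq.
rewrite -(big_map tree_pair predT (fun p => \sum_(r : M.-tuple 'I_n |
   uniq (map (porbit p.2) r) && (tnth r i0 == 0%N :> nat)) degree_weight x p.2 vs r)).
rewrite (perm_big _ pe) /= big_filter pair_big_dep /=.
apply: eq_bigl => -[[al sg] r] /=.
by case: (plane_tree e al sg) => //=; rewrite andbCA.
Qed.

Lemma sum_num_trees0 s M (vs : s.-tuple I) :
  \sum_(d : {ffun 'I_s -> 'I_(2 * 0).+1})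
     (\prod_j x (tnth vs j) ^+ d j) *+ num_trees M 0 (fun j => d j : nat) =
  (M == 1%N)%:R.
Proof.
have only (d : {ffun 'I_s -> 'I_(2 * 0).+1}) j : d j = 0%N :> nat.
  by case: (d j) => -[].
rewrite (big_pred1 [ffun => ord0]) => [|d]; last first.
  by apply/esym/eqP/ffunP => j; apply: val_inj; rewrite /= !only.
rewrite big1 => [|j _]; last by rewrite only.
rewrite /num_trees /=; case: forallP => [_|[]]; first by rewrite andbT.
by move=> j; rewrite only.
Qed.

Section FixedTree.
Variables (e : nat) (b : bintree).
Hypotheses (e_gt0 : (0 < e)%N) (b_e : b \in trees e).
Local Notation n := (2 * e)%N.
Local Notation sg := (vertex_perm n b).

(** The vertices other than the root vertex, with their degrees, in the order of
    [other_cycles]. *)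
Lemma cycles_shape : exists2 cs : seq {set 'I_n},
    uniq cs /\ map (fun C : {set 'I_n} => #|C|) cs = map size (other_cycles b)
  & forall o : 'I_n, o = 0%N :> nat ->
    [/\ #|porbit sg o| = size (root_cycle b), porbit sg o \notin cs
      & porbits sg =i porbit sg o :: cs].
Proof.
have /eqP be : nodes b == e by rewrite -mem_trees.
have nb : n = (2 * nodes b)%N by rewrite be.
have n0 : (0 < n)%N by lia.
have [+ +] := porbits_vertex_perm nb n0 => /= /andP[nr ucs] pm.
exists (map (ord_set n) (other_cycles b)).
  split=> //; rewrite -map_comp; apply/eq_in_map => c cb /=.
  by rewrite (card_cycles nb) // in_cons cb orbT.
move=> o o0.
have eo : porbit sg o = ord_set n (root_cycle b).
  by apply: (porbit_cycles nb); rewrite ?mem_head //= o0 (mem0_root_cycle nb n0).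
by split; rewrite ?eo // (card_cycles nb) ?mem_head.
Qed.

(** The first root is at position 0, and the other roots are labels placed on the
    vertices outside the root vertex. *)
Lemma sum_rooted_first m v (vs : seq I) : size vs = m -> uniq vs ->
  \sum_(r : m.+1.-tuple 'I_n |
          uniq (map (porbit sg) r) && (tnth r ord0 == 0%N :> nat))
     degree_weight x sg (v :: vs) r =
  x v ^+ size (root_cycle b) * place x (map size (other_cycles b)) [set i in vs].
Proof.
move=> <- uvs; have [cs [ucs <-] csP] := cycles_shape.
have n0 : (0 < n)%N by lia.
pose o := Ordinal n0; have [co no pm] := csP o erefl.
have cs_sub : {subset cs <= porbits sg} by move=> C Ccs; rewrite pm in_cons Ccs orbT.
rewrite -(sum_tuples_place x uvs ucs cs_sub) big_tuple_cons (bigD1 o) //=.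
rewrite [X in _ + X]big1 ?addr0 => [|h ho]; last first.
  rewrite big_pred0 // => r; apply/negP => /andP[_ /eqP e0].
  by case/eqP: ho; apply: val_inj.
rewrite big_distrr /=; apply: eq_big => [r|r _]; last first.
  by rewrite /degree_weight big_cons co.
rewrite andbT andbC; congr (_ && _); rewrite -has_pred1 -all_predC.
apply: eq_in_all => C /mapP[h _ ->] /=.
have : porbit sg h \in porbits sg by apply: imset_f.
rewrite pm in_cons; by case: eqP => [-> _|_ /= ->] //; rewrite (negPf no).
Qed.

(** Here the root at position 0 is the last one, whose degree is not recorded. *)
Lemma sum_rooted_last m (vs : seq I) : size vs = m -> uniq vs ->
  \sum_(r : m.+1.-tuple 'I_n |
          uniq (map (porbit sg) r) && (tnth r ord_max == 0%N :> nat))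
     degree_weight x sg vs r =
  place x (map size (other_cycles b)) [set i in vs].
Proof.
move=> <- uvs; have [cs [ucs <-] csP] := cycles_shape.
have n0 : (0 < n)%N by lia.
pose o := Ordinal n0; have [co no pm] := csP o erefl.
have cs_sub : {subset cs <= porbits sg} by move=> C Ccs; rewrite pm in_cons Ccs orbT.
rewrite -(sum_tuples_place x uvs ucs cs_sub) big_tuple_rcons (exchange_big_dep predT) //=.
rewrite (bigD1 o) //=.
have tl (r : (size vs).-tuple 'I_n) h : tnth [tuple of rcons r h] ord_max = h.
  by rewrite (tnth_nth h) /= nth_rcons size_tuple ltnn eqxx.
rewrite [X in _ + X]big1 ?addr0 => [|h ho]; last first.
  rewrite big_pred0 // => r; apply/negP => /andP[_ /eqP].
  by rewrite tl => e0; case/eqP: ho; apply: val_inj.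
apply: eq_big => [r|r _]; last first.
  by rewrite /= degree_weight_rcons // size_tuple.
rewrite tl eqxx andbT map_rcons rcons_uniq andbC; congr (_ && _).
rewrite -has_pred1 -all_predC.
apply: eq_in_all => C /mapP[h _ ->] /=.
have : porbit sg h \in porbits sg by apply: imset_f.
rewrite pm in_cons; by case: eqP => [-> _|_ /= ->] //; rewrite (negPf no).
Qed.

End FixedTree.
End Expansion.

(** * Coefficients of power series and derivations of polynomials *)

Section FpsCoef.
Variable A : comNzRingType.
Implicit Types f g : fps A.

Lemma fps_sumE (I : Type) (r : seq I) (P : pred I) (F : I -> fps A) e :
  (\sum_(i <- r | P i) F i) e = \sum_(i <- r | P i) F i e.
Proof.
elim/big_rec2: _ => [|i x f _ <- //]; by rewrite /= if_same.
Qed.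

Lemma fps_mulE f g e : (f * g) e = \sum_(i < e.+1) f i * g (e - i)%N.
Proof. by []. Qed.

Lemma fps_tmul0 f : (fps_t * f) 0%N = 0.
Proof. by rewrite fps_mulE big_ord1 mul0r. Qed.

Lemma fps_tmulS f e : (fps_t * f) e.+1 = f e.
Proof.
rewrite fps_mulE big_ord_recl mul0r add0r big_ord_recl /= mul1r subSS subn0.
by rewrite big1 ?addr0 // => i _; rewrite mul0r.
Qed.

Lemma fps_constmul a f e : (fps_const a * f) e = a * f e.
Proof.
rewrite fps_mulE big_ord_recl /= subn0 big1 ?addr0 // => i _.
by rewrite mul0r.
Qed.

Lemma fps_mapE (B : Type) (u : A -> B) f e : fps_map u f e = u (f e).
Proof. by []. Qed.

End FpsCoef.

Section Derivations.
Variable n : nat.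
Implicit Types (k r : 'I_n) (p q : {mpoly int[n]}).

Lemma mderivU k r : ('X_k : {mpoly int[n]})^`M(r) = (k == r)%:R.
Proof.
rewrite mderivX mnm1E; case: eqP => [->|_]; last by rewrite scale0r.
by rewrite scale1r -[X in (X - _)%MM]add0m addmK mpolyX0.
Qed.

Lemma mderiv_natmul r p m : mderiv r p = 0 -> mderiv r (m%:R * p) = 0.
Proof. by move=> dp; rewrite mulr_natl mderivMn dp mul0rn. Qed.

Lemma mderiv_exp0 r p m : mderiv r p = 0 -> mderiv r (p ^+ m) = 0.
Proof.
move=> dp; elim: m => [|m IHm]; first by rewrite expr0 -mpolyC1 mderivC.
by rewrite exprS mderivM dp IHm mul0r mulr0 addr0.
Qed.

Lemma mderiv_expU r m : mderiv r ('X_r ^+ m.+1) = m.+1%:R * 'X_r ^+ m :> {mpoly int[n]}.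
Proof.
elim: m => [|m IHm]; first by rewrite expr1 mderivU eqxx mulr1.
rewrite exprS mderivM mderivU eqxx IHm mul1r mulrCA -exprS.
by rewrite -[m.+2%:R]natr1 mulrDl mul1r addrC.
Qed.

Lemma mderiv_place r ms (S : {set 'I_n}) :
  r \notin S -> mderiv r (place (fun k => 'X_k : {mpoly int[n]}) ms S) = 0.
Proof.
elim: ms S => [|m ms IHms] S rS /=.
  by case: (_ == _); rewrite ?mderiv0 // -mpolyC1 mderivC.
rewrite mderivD IHms // add0r raddf_sum big1 //= => k kS.
rewrite mderivM IHms; last by rewrite !inE negb_and rS orbT.
rewrite mulr0 addr0 mderiv_natmul ?mul0r // mderiv_exp0 // mderivU.
by case: eqP => // kr; rewrite kr (negPf rS) in kS.
Qed.

(** The Euler operator, which multiplies a monomial by its degree. *)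
Definition euler p := \sum_(k < n) 'X_k * mderiv k p.

Lemma eulerM p q : euler (p * q) = euler p * q + p * euler q.
Proof.
rewrite /euler mulr_suml mulr_sumr -big_split /=; apply: eq_bigr => k _.
by rewrite mderivM mulrDr; congr (_ + _); [apply: mulrA | apply: mulrCA].
Qed.

Lemma eulerU r : euler 'X_r = 'X_r.
Proof.
rewrite /euler (bigD1 r) //= mderivU eqxx mulr1 big1 ?addr0 // => k kr.
by rewrite mderivU eq_sym (negPf kr) mulr0.
Qed.

Lemma euler_sum (T : Type) (s : seq T) (P : pred T) (F : T -> {mpoly int[n]}) :
  euler (\sum_(i <- s | P i) F i) = \sum_(i <- s | P i) euler (F i).
Proof.
rewrite /euler exchange_big /=; apply: eq_bigr => k _.
by rewrite raddf_sum mulr_sumr.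
Qed.

Lemma euler_monomial (T : Type) (s : seq T) (c : T -> 'I_n) (d : T -> nat) :
  euler (\prod_(i <- s) 'X_(c i) ^+ d i) =
  (\sum_(i <- s) d i)%:R * \prod_(i <- s) 'X_(c i) ^+ d i.
Proof.
have e1 : euler 1 = 0.
  by rewrite /euler big1 // => k _; rewrite -mpolyC1 mderivC mulr0.
have eX r m : euler ('X_r ^+ m) = m%:R * 'X_r ^+ m.
  elim: m => [|m IHm]; first by rewrite expr0 e1 mul0r.
  by rewrite exprS eulerM eulerU IHm mulrCA -exprS -[in RHS]natr1 mulrDl mul1r addrC.
elim: s => [|i s IHs]; first by rewrite !big_nil e1 mul0r.
rewrite !big_cons eulerM eX IHs natrD mulrDl !mulrA; congr (_ + _).
by rewrite -!mulrA mulrCA.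
Qed.

End Derivations.

(** * The generating functions as sums over binary trees *)

Lemma gen_coef N s e :
  gen N s e = \sum_(d : {ffun 'I_s -> 'I_(2 * e).+1})
     (\prod_j 'X_(tnth (ord_tuple s) j) ^+ d j) *+ num_trees N e (fun j => d j : nat).
Proof.
apply: eq_bigr => d _; rewrite scaler_nat; congr (_ *+ _).
by apply: eq_bigr => j _; rewrite tnth_ord_tuple.
Qed.

Lemma gen_at_coef n M (vs : seq 'I_n) e :
  gen_at M vs e = \sum_(d : {ffun 'I_(size vs) -> 'I_(2 * e).+1})
     (\prod_j 'X_(tnth (in_tuple vs) j) ^+ d j) *+ num_trees M e (fun j => d j : nat).
Proof.
rewrite /gen_at /= raddf_sum /=; apply: eq_bigr => d _.
rewrite scaler_nat comp_mpolyMn rmorph_prod; congr (_ *+ _).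
apply: eq_bigr => j _; rewrite rmorphXn /= comp_mpolyXU -tnth_nth tnth_mktuple //.
Qed.

Section TreeSums.
Variable n : nat.
Let X (k : 'I_n) : {mpoly int[n]} := 'X_k.

Definition root_degree b := size (root_cycle b).
Definition other_degrees b := map size (other_cycles b).

(** The contour starts at the root carrying [v]. *)
Lemma gen_at_first (v : 'I_n) (S : {set 'I_n}) e :
  gen_at #|S|.+1 (v :: enum S) e =
  \sum_(b <- trees e) 'X_v ^+ root_degree b * place X (other_degrees b) S.
Proof.
rewrite gen_at_coef; case: e => [|e].
  rewrite (sum_num_trees0 X) big_trees0 /= expr0 mul1r eqSS.
  by rewrite cards_eq0.
rewrite (sum_num_trees X ord0 (in_tuple (v :: enum S))) //; last by rewrite /= -cardE.
rewrite big_seq [RHS]big_seq; apply: eq_bigr => b be /=.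
rewrite (sum_rooted_first X _ be) ?enum_uniq -?cardE //; congr (_ * place _ _ _).
by apply/setP => i; rewrite inE mem_enum.
Qed.

(** The contour starts at the unconstrained root. *)
Lemma gen_at_last (S : {set 'I_n}) e :
  gen_at #|S|.+1 (enum S) e =
  \sum_(b <- trees e) place X (other_degrees b) S.
Proof.
rewrite gen_at_coef; case: e => [|e].
  by rewrite (sum_num_trees0 X) big_trees0 /= eqSS cards_eq0.
rewrite (sum_num_trees X ord_max (in_tuple (enum S))) //; last by rewrite /= -cardE.
rewrite big_seq [RHS]big_seq; apply: eq_bigr => b be /=.
rewrite (sum_rooted_last X _ be) ?enum_uniq -?cardE //; congr (place _ _ _).
by apply/setP => i; rewrite inE mem_enum.
Qed.

End TreeSums.

Lemma gen_full N e :
  gen N.+1 N.+1 e =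
  \sum_(b <- trees e) 'X_ord0 ^+ root_degree b
     * place (fun k => 'X_k) (other_degrees b) [set~ ord0].
Proof.
rewrite gen_coef; pose X (k : 'I_N.+1) : {mpoly int[N.+1]} := 'X_k.
case: e => [|e].
  rewrite (sum_num_trees0 X) big_trees0 /= expr0 mul1r eqSS.
  by rewrite -cards_eq0 cardsC1 card_ord.
rewrite (sum_num_trees X ord0) //.
rewrite big_seq [RHS]big_seq; apply: eq_bigr => b be /=.
have sz : size (map (lift ord0) (enum 'I_N)) = N by rewrite size_map size_enum_ord.
rewrite enum_ordSl (sum_rooted_first X _ be _ sz) //; last first.
  by rewrite map_inj_uniq ?enum_uniq //; apply: lift_inj.
congr (_ * place _ _ _); apply/setP => i; rewrite !inE.
apply/mapP/idP => [[j _ ->] //|]; have [j ->|->] := unliftP ord0 i; rewrite ?eqxx // => _.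
by exists j; rewrite ?mem_enum.
Qed.

(** The head of [other_degrees (Node l r)] is the far end of the root edge, and
    the two sums correspond to this vertex carrying no label or the label [k]. *)
Lemma place_node n (x : 'I_n -> {mpoly int[n]}) l r S :
  place x (other_degrees (Node l r)) S =
  \sum_(IJ : {set 'I_n} * {set 'I_n} | (IJ.1 :|: IJ.2 == S) && (IJ.1 :&: IJ.2 == set0))
     place x (other_degrees l) IJ.1 * place x (other_degrees r) IJ.2
  + \sum_(k in S) place1 x k (root_degree r).+1 *
    \sum_(IJ : {set 'I_n} * {set 'I_n} | (IJ.1 :|: IJ.2 == S :\ k) && (IJ.1 :&: IJ.2 == set0))
     place x (other_degrees l) IJ.1 * place x (other_degrees r) IJ.2.
Proof.
have e : other_degrees (Node l r) =
    (root_degree r).+1 :: other_degrees l ++ other_degrees r.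
  rewrite /other_degrees /= size_map map_cat; congr (_ :: _ ++ _).
    by rewrite -map_comp; apply: eq_map => c /=; rewrite size_map.
  by rewrite -map_comp; apply: eq_map => c /=; rewrite size_map.
rewrite e /= place_cat; congr (_ + _); apply: eq_bigr => k _.
by rewrite place_cat.
Qed.

Lemma root_degree_node l r : root_degree (Node l r) = (root_degree l).+1.
Proof. by rewrite /root_degree /= size_map. Qed.

(** The last root ranges over the half-edges outside the vertices of the others.
    On a monomial, [euler] counts the half-edges of these vertices. *)
Lemma sum_tuples_free_root e b m (vs : m.+1.-tuple 'I_m.+1) :
  let sg := vertex_perm (2 * e) b in
  let X (k : 'I_m.+1) : {mpoly int[m.+1]} := 'X_k in
  let G := \sum_(r : m.+1.-tuple 'I_(2 * e) |
              uniq (map (porbit sg) r) && (tnth r ord0 == 0%N :> nat))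
             degree_weight X sg vs r in
  \sum_(r : m.+2.-tuple 'I_(2 * e) |
          uniq (map (porbit sg) r) && (tnth r ord0 == 0%N :> nat))
     degree_weight X sg vs r = (2 * e)%:R * G - euler G.
Proof.
move=> sg X G; rewrite /G euler_sum mulr_sumr -sumrB big_tuple_rcons.
rewrite [RHS]big_mkcond; apply: eq_bigr => r _.
have t0 h : tnth [tuple of rcons r h] ord0 = tnth r ord0.
  by rewrite !(tnth_nth h) /= nth_rcons size_tuple.
under eq_bigl do rewrite t0 map_rcons rcons_uniq -andbA andbC.
case: ifP => rP; last by rewrite big_pred0.
have /andP[ur _] := rP; set cs := map (porbit sg) r in ur *.
have cs_sub : {subset cs <= porbits sg}.
  by move=> C /mapP[h _ ->]; apply: imset_f.
under eq_bigr do rewrite degree_weight_rcons ?size_tuple //.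
under eq_bigl do rewrite andTb.
rewrite euler_monomial -/(degree_weight X sg vs r) -mulrBl sumr_const -[LHS]mulr_natl.
congr (_ * _); apply/eqP; rewrite eq_sym subr_eq -natrD; apply/eqP; congr (_%:R).
(* Half-edges at occupied vertices, counted vertex by vertex. *)
have -> : \sum_(p <- zip vs r) #|porbit sg p.2| = \sum_(C <- cs) #|C|.
  rewrite big_map -(big_map snd predT (fun h => #|porbit sg h|)).
  by rewrite -/(unzip2 _) unzip2_zip // !size_tuple.
have := sum_porbits (fun=> 1%N) ur cs_sub; under [RHS]eq_bigr do rewrite natn.
move=> <-; rewrite sum1_card addnC -[LHS]card_ord.
rewrite -[LHS](cardID [pred h | porbit sg h \in cs]).
by congr (_ + _)%N; apply: eq_card => h; rewrite !inE ?andbT.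
Qed.

(** The exclusion of the occupied vertices turns the factor [2 * e] into the
    operator [2 * e - euler]. For [e = 0] both sides vanish: there is no tree
    with two roots, and [euler] kills constants. *)
Lemma gen_free_root m e :
  gen m.+2 m.+1 e = (2 * e)%:R * gen m.+1 m.+1 e - euler (gen m.+1 m.+1 e).
Proof.
pose X (k : 'I_m.+1) : {mpoly int[m.+1]} := 'X_k.
rewrite !gen_coef; case: e => [|e].
  rewrite !(sum_num_trees0 X) /= mul0r sub0r; case: m X => [|m] X.
    by rewrite /euler big1 ?oppr0 // => k _; rewrite -mpolyC1 mderivC mulr0.
  by rewrite /euler big1 ?oppr0 // => k _; rewrite mderiv0 mulr0.
rewrite !(sum_num_trees X ord0) // mulr_sumr euler_sum -sumrB.
by apply: eq_bigr => b _; apply: sum_tuples_free_root.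
Qed.

Lemma gen_root_edge N e :
  gen N.+1 N.+1 e.+1 = 'X_ord0 * \sum_(i < e.+1)
    \sum_(l <- trees i) \sum_(r <- trees (e - i))
      'X_ord0 ^+ root_degree l *
       place (fun k => 'X_k) (other_degrees (Node l r)) [set~ ord0].
Proof.
rewrite gen_full big_treesS mulr_sumr; apply: eq_bigr => i _.
rewrite mulr_sumr; apply: eq_bigr => l _.
rewrite mulr_sumr; apply: eq_bigr => r _.
by rewrite root_degree_node exprS mulrA.
Qed.

(** The derivative of [x_r^(d + 1)] is [(d + 1) x_r^d]: the far end of the root
    edge has degree [d + 1], and its root may be any of its half-edges. *)
Lemma mderiv_gen_at n (r : 'I_n) (S : {set 'I_n}) e : r \notin S ->
  'X_r * mderiv r ('X_r * gen_at #|S|.+1 (r :: enum S) e) =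
  \sum_(b <- trees e) place1 (fun k => 'X_k) r (root_degree b).+1
      * place (fun k => 'X_k) (other_degrees b) S.
Proof.
move=> rS; rewrite gen_at_first [X in mderiv r X]mulr_sumr raddf_sum mulr_sumr /=.
apply: eq_bigr => b _.
rewrite mulrA -exprS mderivM mderiv_place // mulr0 addr0 mderiv_expU.
by rewrite /place1 exprS [LHS]mulrA; congr (_ * _); apply: mulrCA.
Qed.

(** * The two recursions *)

Theorem proposition2 (N : nat) (hN : (2 <= N)%N) :
  let x1 : 'I_N := Ordinal (ltnW hN) in
  gen N N.-1 =
    2 * fps_t * fps_deriv (gen N.-1 N.-1)
    - \sum_(k < N.-1) fps_const 'X_k * fps_map (mderiv k) (gen N.-1 N.-1)
  /\
  gen N N =
    fps_t * fps_const 'X_x1 *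
      (\sum_(IJ : {set 'I_N} * {set 'I_N}
             | (IJ.1 :|: IJ.2 == [set~ x1]) && (IJ.1 :&: IJ.2 == set0))
          gen_at #|IJ.1|.+1 (x1 :: enum IJ.1) * gen_at #|IJ.2|.+1 (enum IJ.2))
    + fps_t * fps_const 'X_x1 *
      (\sum_(r : 'I_N | r != x1)
       \sum_(IJ : {set 'I_N} * {set 'I_N}
             | (IJ.1 :|: IJ.2 == [set~ x1] :\ r) && (IJ.1 :&: IJ.2 == set0))
          fps_const 'X_r * gen_at #|IJ.1|.+1 (x1 :: enum IJ.1)
          * fps_map (mderiv r)
              (fps_const 'X_r * gen_at #|IJ.2|.+1 (r :: enum IJ.2))).
Proof.
case: N hN => [|[|m]] // hN x1.
have {x1}-> : x1 = ord0 by apply: val_inj.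
split; apply/fpsP => e.
  rewrite gen_free_root -[RHS]/(_ - _) fps_sumE; congr (_ - _).
    rewrite -mulrA [2 * _ in RHS]mulr_natl mulr2n -[RHS]/(_ + _).
    case: e => [|e]; first by rewrite fps_tmul0 muln0 mul0r addr0.
    by rewrite fps_tmulS /= -mulrnDr addnn -mul2n mulr_natl.
  by apply: eq_bigr => k _; rewrite fps_constmul.
rewrite -mulrDr -mulrA; case: e => [|e].
  rewrite fps_tmul0 gen_full big_trees0 /= [_ == _](_ : _ = false) ?mulr0 //.
  by apply/negbTE; rewrite -cards_eq0 cardsC1 card_ord.
rewrite fps_tmulS fps_constmul gen_root_edge; congr (_ * _).
rewrite -[RHS]/(_ + _) !fps_sumE.
under eq_bigr do under eq_bigr do under eq_bigr do rewrite place_node mulrDr.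
under eq_bigr do under eq_bigr do rewrite big_split /=.
under eq_bigr do rewrite big_split /=.
rewrite big_split; congr (_ + _).
  under eq_bigr do under eq_bigr do under eq_bigr do rewrite mulr_sumr.
  under eq_bigr do under eq_bigr do rewrite exchange_big /=.
  under eq_bigr do rewrite exchange_big /=.
  rewrite exchange_big; apply: eq_bigr => IJ _.
  rewrite fps_mulE; apply: eq_bigr => i _.
  rewrite gen_at_first gen_at_last mulr_suml; apply: eq_bigr => l _.
  by rewrite mulr_sumr; apply: eq_bigr => r _; rewrite mulrA.
under eq_bigr do under eq_bigr do under eq_bigr do rewrite mulr_sumr.
under eq_bigr do under eq_bigr do rewrite exchange_big /=.
under eq_bigr do rewrite exchange_big /=.
rewrite exchange_big; apply: eq_big => [k|k _]; first by rewrite !inE.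
rewrite fps_sumE.
under eq_bigr do under eq_bigr do under eq_bigr do rewrite 2!mulr_sumr.
under eq_bigr do under eq_bigr do rewrite exchange_big /=.
under eq_bigr do rewrite exchange_big /=.
rewrite exchange_big; apply: eq_bigr => IJ /andP[/eqP eIJ _].
have kJ : k \notin IJ.2.
  by have := setD11 k [set~ ord0]; rewrite -eIJ inE => /norP[].
rewrite -mulrA fps_constmul fps_mulE mulr_sumr; apply: eq_bigr => i _.
rewrite [RHS]mulrCA (fps_mapE (mderiv k)) fps_constmul mderiv_gen_at // gen_at_first.
rewrite mulr_suml; apply: eq_bigr => l _; rewrite mulr_sumr; apply: eq_bigr => r _.
by rewrite -[RHS]mulrA; congr (_ * _); apply: mulrCA.
Qed.
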